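(* Let $m\in\mathbb N\setminus\{0\}$, $p\in\mathbb N$, $n\geqslant 2$. Assume that: (1) $f$ is bounded on $I$; (2) for every $j\in\{1,\dots,m\}$, $\varphi_j'\in\mathcal S_{j+p}$; (3) (stability at level $m+p$) $\mathfrak L(m+p)<\infty$ and $\mathfrak L(m+p)(\|\Psi_{m+p}^{-1}\|_{\rm op}\vee1)\leqslant\frac{\mathfrak c}{2}\cdot\frac{n}{\log(n)}$, where $\mathfrak c=(3\log(3/2)-1)/9$; (4) $\mathbb E[b'(X_1)^4]<\infty$ and $\mathbb E(Y_1^4)<\infty$. Then $$\begin{aligned}\mathbb E\left[\|\widetilde b_m^{\prime,1}-b'\|_n^2\right]\leqslant{}&3\|f\|_\infty\inf_{t\in\mathcal S_m}\|t-b'\|^2+9\|\Delta_{m,m+p}^{f,1}\|_{\rm op}^2\|b-b_m\|_f^2+3\|b_m'-(b')_m\|_f^2+\frac{2\sigma^2}{n}\|\Delta_{m,m+p}^{f,1}\|_F^2\\&+\left[\frac{2\mathfrak c n}{\log(n)}\|\Delta_{m,m+p}\|_{\rm op}^2\,\mathbb E(Y_1^4)^{1/2}+3\,\mathbb E(b'(X_1)^4)^{1/2}\right]\frac{\mathfrak c_{8.1}^{1/2}}{n^4},\end{aligned}$$ with $\Delta_{m,m+p}^{f,1}:=\Psi_{m+p}^{1/2}\Delta_{m,m+p}^*\Psi_m^{-1/2}$.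
   Context: Model: $Y_i=b(X_i)+\varepsilon_i$, $i=1,\dots,n$, where $b$ is an unknown continuously differentiable function, $X_1,\dots,X_n$ are i.i.d. real random variables with density $f$ with respect to Lebesgue measure, and $\varepsilon_1,\dots,\varepsilon_n$ are i.i.d., centered, with variance $\sigma^2$, and independent of $X_1,\dots,X_n$. $I\subseteq\mathbb R$ is an interval and $(\varphi_j)_{j\geqslant 1}$ is a Hilbert (orthonormal) basis of $\mathbb L^2(I,dx)$ made of differentiable functions, extended by $0$ outside $I$. $\mathcal S_m={\rm span}\{\varphi_1,\dots,\varphi_m\}$. Estimation takes place on $I$: $b$ and $b'$ stand for $b\mathbf 1_I$ and $b'\mathbf 1_I$, and $b,b'$ are square integrable on $I$. $\psi_m$ denotes the $\mathbb L^2(I,dx)$-orthogonal projection of $\psi$ on $\mathcal S_m$; $b_m'$ is the derivative of $b_m$, and $(b')_m$ is the projection of $b'$. Norms: $\|\cdot\|$ is the norm of $\mathbb L^2(I,dx)$; $\langle\varphi,\psi\rangle_f=\int_I\varphi\psi f\,dx$ with norm $\|\cdot\|_f$; $\|\psi\|_n^2=\frac1n\sum_{i=1}^n\psi(X_i)^2$; $\|f\|_\infty=\sup_I f$; $\|M\|_{\rm op}^2=\lambda_{\max}(MM^* )$, $\|M\|_F^2={\rm Tr}(MM^* )$, with $M^*$ the transpose of $M$. Matrices: $\widehat\Phi_m=(\varphi_j(X_i))_{1\leqslant i\leqslant n,1\leqslant j\leqslant m}$, $\widehat\Psi_m=\frac1n\widehat\Phi_m^*\widehat\Phi_m$, $\Psi_m=\mathbb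 E(\widehat\Psi_m)=(\langle\varphi_j,\varphi_k\rangle_f)_{1\leqslant j,k\leqslant m}$, $\mathfrak L(m)=\sup_{x\in I}\sum_{j=1}^m\varphi_j(x)^2$, $\mathbf Y=(Y_1,\dots,Y_n)^*$. The operator norm of the inverse of a singular matrix is $+\infty$. $\Delta_{m,m+p}$ is the $m\times(m+p)$ matrix with $\varphi_j'=\sum_{k=1}^{m+p}[\Delta_{m,m+p}]_{j,k}\varphi_k$, $j=1,\dots,m$. Estimator: $\widehat b_m^{\prime,1}(x)=\sum_{j=1}^m[\widehat\theta_m^1]_j\varphi_j'(x)$ with $\widehat\theta_m^1=\frac1n\widehat\Psi_m^{-1}\widehat\Phi_m^*\mathbf Y$; its truncated version is $\widetilde b_m^{\prime,1}=\widehat b_m^{\prime,1}\mathbf 1_{\Lambda_{m+p}}$, where $\Lambda_m=\{\mathfrak L(m)(\|\widehat\Psi_m^{-1}\|_{\rm op}\vee1)\leqslant\mathfrak c\,n/\log(n)\}$. Constant: $\mathfrak c_{8.1}>0$ is a deterministic constant, not depending on $m$ and $n$, such that whenever $\mathfrak L(m)(\|\Psi_m^{-1}\|_{\rm op}\vee1)\leqslant\frac{\mathfrak c}{2}\frac{n}{\log n}$ one has $\mathbb P(\Omega_m^c)\leqslant\mathfrak c_{8.1}/n^8$ and $\mathbb P(\Lambda_m^c)\leqslant\mathfrak c_{8.1}/n^8$, where $\Omega_m=\{|\|t\|_n^2/\|t\|_f^2-1|\leqslant\frac12,\ \forall t\in\mathcal S_m\}$ (such a constant exists by a known result of Comte and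 Genon-Catalot). *)

(* Defs.v *)
From mathcomp Require Import all_boot all_order all_algebra.
From mathcomp Require Import all_classical all_reals all_analysis.

Set Implicit Arguments.
Unset Strict Implicit.
Unset Printing Implicit Defensive.

Import Order.TTheory GRing.Theory Num.Theory.
Import numFieldNormedType.Exports.

Local Open Scope classical_set_scope.
Local Open Scope ring_scope.

(* Throughout, bases are indexed from 0: [phi j] is the (j+1)-st basis
   function, so that [calS phi m] is spanned by the first m of them. *)

(** * Derivatives and square-integrable functions on an interval *)

(* Difference quotients at x only use points of I, so the derivative is
   one-sided at an endpoint that belongs to I, where a basis function extended
   by 0 need not even be continuous on the whole line. *)
Definition diff_quotient (R : realType) (g : R -> R) (x h : R) : R :=
  h^-1 * (g (x + h) - g x).

Definition derivable_on (R : realType) (I : set R) (g : R -> R) : Prop :=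
  forall x, I x -> cvg (diff_quotient g x @ within [set h | I (x + h)] 0^').

(* The derivative on I, extended by 0 outside I. *)
Definition deriv_on (R : realType) (I : set R) (g : R -> R) (x : R) : R :=
  lim (diff_quotient g x @ within [set h | I (x + h)] 0^') * \1_I x.

Definition square_integrable (R : realType) (I : set R) (g : R -> R) : Prop :=
  measurable_fun I g /\
  (@lebesgue_measure R).-integrable I (fun x => (g x ^+ 2)%:E).

Definition dotL2 (R : realType) (I : set R) (g h : R -> R) : R :=
  \int[@lebesgue_measure R]_(x in I) (g x * h x).

Definition dotf (R : realType) (I : set R) (f g h : R -> R) : R :=
  \int[@lebesgue_measure R]_(x in I) (g x * h x * f x).

Definition sqnormL2 (R : realType) (I : set R) (g : R -> R) : R :=
  dotL2 I g g.

Definition sqnormf (R : realType) (I : set R) (f g : R -> R) : R :=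
  dotf I f g g.

Definition lincomb (R : realType) (phi : nat -> R -> R) (m : nat)
    (c : 'I_m -> R) (x : R) : R :=
  \sum_(j < m) c j * phi j x.

Definition calS (R : realType) (phi : nat -> R -> R) (m : nat)
    : set (R -> R) :=
  [set t | exists c : 'I_m -> R, t = lincomb phi c].

(* Orthonormal, with linear span dense in L^2(I, dx). *)
Definition hilbert_basis (R : realType) (I : set R) (phi : nat -> R -> R)
    : Prop :=
  [/\ forall j, square_integrable I (phi j),
      forall j k, dotL2 I (phi j) (phi k) = (j == k)%:R
    & forall g, square_integrable I g -> forall e : R, 0 < e ->
        exists m : nat, exists2 t, calS phi m t & sqnormL2 I (g \- t) < e].

Definition is_orthogonal_projection (R : realType) (I : set R)
    (phi : nat -> R -> R) (m : nat) (g gm : R -> R) : Prop :=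
  calS phi m gm /\ forall t, calS phi m t -> dotL2 I (g \- gm) t = 0.

(** * Matrices *)

Definition lambda_max (R : realType) (k : nat) (A : 'M[R]_k) : R :=
  sup [set a : R | eigenvalue A a].

Definition opnorm (R : realType) (k l : nat) (M : 'M[R]_(k, l)) : R :=
  Num.sqrt (lambda_max (M *m M^T)).

Definition frobnorm (R : realType) (k l : nat) (M : 'M[R]_(k, l)) : R :=
  Num.sqrt (\tr (M *m M^T)).

(* [invmx] returns its argument on a singular matrix, so that case is treated
   separately. *)
Definition opnorm_inv (R : realType) (k : nat) (M : 'M[R]_k) : \bar R :=
  if M \in unitmx then (opnorm (invmx M))%:E else +oo%E.

Definition psd (R : realType) (k : nat) (A : 'M[R]_k) : Prop :=
  A^T = A /\ forall v : 'rV[R]_k, 0 <= (v *m A *m v^T) 0 0.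

Definition sqrtmx (R : realType) (k : nat) (A : 'M[R]_k) : 'M[R]_k :=
  xget 0 [set S | psd S /\ S *m S = A].

(** * The regression model *)

Section Independence.
Context (R : realType) (d : measure_display) (T : measurableType d).
Context (P : probability T R).

Definition mutually_independent (n : nat) (X : 'I_n -> {RV P >-> R}) : Prop :=
  forall (J : {set 'I_n}) (B : 'I_n -> set R),
    (forall i, measurable (B i)) ->
    P (\bigcap_(i in [set` J]) (X i @^-1` B i)) =
      (\prod_(i in J) P (X i @^-1` B i))%E.

Definition sigma_algebra_of (n : nat) (X : 'I_n -> {RV P >-> R})
    : set (set T) :=
  <<s \bigcup_i preimage_set_system setT (X i) (@measurable _ R) >>.

Definition independent_families (n k : nat) (X : 'I_n -> {RV P >-> R})
    (Z : 'I_k -> {RV P >-> R}) : Prop :=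
  forall E F, sigma_algebra_of X E -> sigma_algebra_of Z F ->
    P (E `&` F) = (P E * P F)%E.

Definition has_density (X : {RV P >-> R}) (f : R -> R) : Prop :=
  [/\ measurable_fun setT f, forall x, 0 <= f x
    & forall B : set R, measurable B ->
        distribution P X B = (\int[lebesgue_measure]_(x in B) (f x)%:E)%E].

Definition iid_density (n : nat) (X : 'I_n -> {RV P >-> R}) (f : R -> R)
    : Prop :=
  mutually_independent X /\ forall i, has_density (X i) f.

Definition iid (n : nat) (X : 'I_n -> {RV P >-> R}) : Prop :=
  mutually_independent X /\
  forall i j (B : set R), measurable B ->
    distribution P (X i) B = distribution P (X j) B.

Definition response (b : R -> R) (n : nat) (X eps : 'I_n -> {RV P >-> R})
    (i : 'I_n) (w : T) : R :=
  b (X i w) + eps i w.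

End Independence.

(* The index of the first observation. *)
Definition first (n : nat) (hn : (1 < n)%N) : 'I_n := Ordinal (ltnW hn).

(** * The least squares estimator of the derivative *)

(* Design points and responses are given by their values [x] and [y] at a
   fixed outcome. *)

Definition sqnorm_emp (R : realType) (n : nat) (x : 'I_n -> R) (g : R -> R)
    : R :=
  n%:R^-1 * \sum_(i < n) g (x i) ^+ 2.

Definition Phihat (R : realType) (phi : nat -> R -> R) (m n : nat)
    (x : 'I_n -> R) : 'M[R]_(n, m) :=
  \matrix_(i < n, j < m) phi j (x i).

Definition Psihat (R : realType) (phi : nat -> R -> R) (m n : nat)
    (x : 'I_n -> R) : 'M[R]_m :=
  n%:R^-1 *: ((Phihat phi m x)^T *m Phihat phi m x).

Definition Psi (R : realType) (I : set R) (phi : nat -> R -> R) (f : R -> R)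
    (m : nat) : 'M[R]_m :=
  \matrix_(j < m, k < m) dotf I f (phi j) (phi k).

Definition calL (R : realType) (I : set R) (phi : nat -> R -> R) (m : nat)
    : \bar R :=
  ereal_sup [set (\sum_(j < m) phi j x ^+ 2)%:E | x in I].

Definition cfrak (R : realType) : R := (3 * ln (3 / 2) - 1) / 9.

Definition stable (R : realType) (I : set R) (phi : nat -> R -> R)
    (f : R -> R) (m n : nat) : Prop :=
  (calL I phi m * maxe (opnorm_inv (Psi I phi f m)) 1 <=
     (cfrak R / 2 * (n%:R / ln n%:R))%:E)%E.

Definition theta_hat (R : realType) (phi : nat -> R -> R) (m n : nat)
    (x y : 'I_n -> R) : 'cV[R]_m :=
  n%:R^-1 *: (invmx (Psihat phi m x) *m (Phihat phi m x)^T *m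
                \col_(i < n) y i).

Definition db_hat (R : realType) (I : set R) (phi : nat -> R -> R) (m n : nat)
    (x y : 'I_n -> R) (u : R) : R :=
  \sum_(j < m) theta_hat phi m x y j 0 * deriv_on I (phi j) u.

Section Events.
Context (R : realType) (d : measure_display) (T : measurableType d).
Context (P : probability T R).

Definition Lambda (I : set R) (phi : nat -> R -> R) (m n : nat)
    (X : 'I_n -> {RV P >-> R}) : set T :=
  [set w | (calL I phi m * maxe (opnorm_inv (Psihat phi m (fun i => X i w))) 1
              <= (cfrak R * n%:R / ln n%:R)%:E)%E].

(* The ratio is meaningless at t = 0, which is left out. *)
Definition Omega (I : set R) (phi : nat -> R -> R) (f : R -> R) (m n : nat)
    (X : 'I_n -> {RV P >-> R}) : set T :=
  [set w | forall t, calS phi m t -> t <> cst 0 ->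
     `|sqnorm_emp (fun i => X i w) t / sqnormf I f t - 1| <= 1 / 2].

Definition db_tilde (I : set R) (phi : nat -> R -> R) (m p n : nat)
    (X : 'I_n -> {RV P >-> R}) (Y : 'I_n -> T -> R) (w : T) (u : R) : R :=
  db_hat I phi m (fun i => X i w) (fun i => Y i w) u *
  \1_(Lambda I phi (m + p) X) w.

(* The constant is uniform in the dimension k, in the sample size N and in the
   i.i.d. sample Z of density f. *)
Definition deviation_constant (I : set R) (phi : nat -> R -> R) (f : R -> R)
    (c : R) : Prop :=
  0 < c /\
  forall (k N : nat) (Z : 'I_N -> {RV P >-> R}),
    (0 < k)%N -> (1 < N)%N -> iid_density Z f -> stable I phi f k N ->
    (P (~` Omega I phi f k Z) <= (c / N%:R ^+ 8)%:E)%E /\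
    (P (~` Lambda I phi k Z) <= (c / N%:R ^+ 8)%:E)%E.

End Events.

(* Main.v *)
Require Import Defs.
From HB Require Import structures.
From mathcomp Require Import all_boot all_order all_algebra.
From mathcomp Require Import all_classical all_reals all_analysis.
From mathcomp Require Import measurable_realfun.
From mathcomp Require Import ring lra.

Set Implicit Arguments.
Unset Strict Implicit.
Unset Printing Implicit Defensive.

Import Order.TTheory GRing.Theory Num.Theory.
Import numFieldNormedType.Exports.

Local Open Scope classical_set_scope.
Local Open Scope ring_scope.

(* For a fixed design the values of the fitted derivative are a linear image
   of the responses under a matrix [H], so on Lambda and Omega the risk splits
   into a noise part [sigma^2 |H|_F^2] and a bias part. On Omega the empirical
   Gram matrices are comparable with [Psi]. For the bias this bounds the squared
   norm of [H] by [3/2 * 2 * |Psi_{m+p}^{1/2} Delta^* Psi_m^{-1/2}|_op^2]. For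
   the noise one only uses [Psihat_m^{-1} <= 2 Psi_m^{-1}], drops the indicator
   of Omega and takes the expectation of [Psihat_{m+p}], hence the factor 2
   instead of 3. On Lambda outside Omega, [|H|_op^2] is still at most
   [c n / log n * |Delta|_op^2], and the Cauchy-Schwarz inequality brings in the
   probabilities of the complements. *)

(** * Quadratic forms on real row vectors *)

(** Conditioning on the design is replaced by sigma-algebras: Lambda, Omega and the entries of [H]
    are measurable for the one generated by the design. The indicator of the good event can
    therefore be absorbed into the coefficients of the noise, and the expanded square is integrated
    term by term with products of independent variables. Both events are rewritten as inequalities
    between quadratic forms for this purpose: in that shape they reduce to countably many
    conditions, they involve no inverse matrix, and they restrict from level m+p to level m by
    padding coefficients with zeros. The level m+p is imposed by the derivatives, which may leave
    the space spanned by the first m basis functions. *)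

Lemma cvg_sumr (R : realType) (T : Type) (F : set_system T) (J : Type)
    (r : seq J) (g : J -> T -> R) (a : J -> R) {FF : Filter F} :
  (forall j, g j x @[x --> F] --> a j) ->
  \sum_(j <- r) g j x @[x --> F] --> \sum_(j <- r) a j.
Proof. by move=> cg; apply: cvg_big => //; exact: add_continuous. Qed.

Section RealMatrices.
Context (R : realType).
Implicit Types (n k l : nat).

Definition dotmx n (u v : 'rV[R]_n) : R := (u *m v^T) 0 0.

Definition qform n (A : 'M[R]_n) (v : 'rV[R]_n) : R := (v *m A *m v^T) 0 0.

Lemma dotmxE n (u v : 'rV[R]_n) : dotmx u v = \sum_i u 0 i * v 0 i.
Proof. by rewrite /dotmx mxE; apply: eq_bigr => i _; rewrite mxE. Qed.

Lemma dotmxC n (u v : 'rV[R]_n) : dotmx u v = dotmx v u.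
Proof. by rewrite !dotmxE; apply: eq_bigr => i _; rewrite mulrC. Qed.

Lemma dotmxDl n (u v w : 'rV[R]_n) : dotmx (u + v) w = dotmx u w + dotmx v w.
Proof. by rewrite /dotmx mulmxDl mxE. Qed.

Lemma dotmxDr n (u v w : 'rV[R]_n) : dotmx w (u + v) = dotmx w u + dotmx w v.
Proof. by rewrite dotmxC dotmxDl !(dotmxC _ w). Qed.

Lemma dotmxZl n a (u v : 'rV[R]_n) : dotmx (a *: u) v = a * dotmx u v.
Proof. by rewrite /dotmx -scalemxAl mxE. Qed.

Lemma dotmxZr n a (u v : 'rV[R]_n) : dotmx u (a *: v) = a * dotmx u v.
Proof. by rewrite dotmxC dotmxZl dotmxC. Qed.

Lemma dotmxBl n (u v w : 'rV[R]_n) : dotmx (u - v) w = dotmx u w - dotmx v w.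
Proof. by rewrite dotmxDl -scaleN1r dotmxZl mulN1r. Qed.

Lemma dotmxBr n (u v w : 'rV[R]_n) : dotmx w (u - v) = dotmx w u - dotmx w v.
Proof. by rewrite dotmxC dotmxBl !(dotmxC _ w). Qed.

Lemma dotmx_mul n k (u : 'rV[R]_n) (M : 'M[R]_(n, k)) (v : 'rV[R]_k) :
  dotmx (u *m M) v = dotmx u (v *m M^T).
Proof. by rewrite /dotmx trmx_mul trmxK mulmxA. Qed.

Lemma dotmxvv_ge0 n (u : 'rV[R]_n) : 0 <= dotmx u u.
Proof. by rewrite dotmxE sumr_ge0// => i _; rewrite -expr2 sqr_ge0. Qed.

Lemma dotmxvv_eq0 n (u : 'rV[R]_n) : (dotmx u u == 0) = (u == 0).
Proof.
apply/idP/eqP => [|->]; last by rewrite /dotmx mul0mx mxE.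
rewrite dotmxE psumr_eq0 => [/allP u0|i _]; last by rewrite -expr2 sqr_ge0.
apply/rowP => i; rewrite mxE; apply/eqP.
by have := u0 i (mem_index_enum _); rewrite mulf_eq0 orbb.
Qed.

Lemma qformE n (A : 'M[R]_n) v : qform A v = dotmx (v *m A) v.
Proof. by []. Qed.

Lemma qform1 n (v : 'rV[R]_n) : qform 1%:M v = dotmx v v.
Proof. by rewrite qformE mulmx1. Qed.

Lemma qform_sum n (A : 'M[R]_n) (v : 'rV[R]_n) :
  qform A v = \sum_i \sum_j v 0 i * A i j * v 0 j.
Proof.
rewrite qformE dotmxE exchange_big; apply: eq_bigr => j _.
by rewrite mxE mulr_suml.
Qed.

Lemma qform_conj n k (A : 'M[R]_k) (M : 'M[R]_(n, k)) v :
  qform A (v *m M) = qform (M *m A *m M^T) v.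
Proof. by rewrite /qform trmx_mul !mulmxA. Qed.

Lemma qform_gram n k (M : 'M[R]_(n, k)) v :
  qform (M *m M^T) v = dotmx (v *m M) (v *m M).
Proof. by rewrite -qform1 qform_conj mulmx1. Qed.

Lemma qform_gram_tr n k (M : 'M[R]_(k, n)) v :
  qform (M^T *m M) v = dotmx (v *m M^T) (v *m M^T).
Proof. by have := qform_gram M^T v; rewrite trmxK. Qed.

Lemma qformZ n (A : 'M[R]_n) a v : qform A (a *: v) = a ^+ 2 * qform A v.
Proof. by rewrite !qformE -scalemxAl dotmxZl dotmxZr expr2 mulrA. Qed.

Lemma qformZm n (A : 'M[R]_n) a v : qform (a *: A) v = a * qform A v.
Proof. by rewrite !qformE -scalemxAr dotmxZl. Qed.

Lemma qformBm n (A B : 'M[R]_n) v : qform (A - B) v = qform A v - qform B v.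
Proof. by rewrite !qformE mulmxBr dotmxBl. Qed.

Lemma qform_symD n (A : 'M[R]_n) u v : A^T = A ->
  qform A (u + v) = qform A u + 2 * dotmx (u *m A) v + qform A v.
Proof.
move=> sA; rewrite !qformE mulmxDl !(dotmxDl, dotmxDr).
have -> : dotmx (v *m A) u = dotmx (u *m A) v by rewrite dotmx_mul sA dotmxC.
ring.
Qed.

(** A point where a nonnegative form vanishes is a minimum, so the form cannot decrease along
    [v *m A], where its slope is twice the squared norm of [v *m A]. *)
Lemma psd_isotropic n (A : 'M[R]_n) v : psd A -> qform A v = 0 -> v *m A = 0.
Proof.
move=> [sA Age0] qv; apply/eqP; rewrite -dotmxvv_eq0; set s := dotmx _ _.
have s0 : 0 <= s by exact: dotmxvv_ge0.
pose q := qform A (v *m A); have q0 : 0 <= q by exact: Age0.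
(* The minimizer of [2 * t * s + t ^+ 2 * q] is [- s / q]; taking [1 + q] covers [q = 0] and still
   gives a negative value unless [s = 0]. *)
pose t := - s / (1 + q).
have q1 : 1 + q != 0 by rewrite gt_eqF// ltr_pwDl.
have : 0 <= qform A (v + t *: (v *m A)) by exact: Age0.
rewrite (qform_symD _ _ sA) qv add0r qformZ dotmxZr -/s -/q /t.
have -> : 2 * (- s / (1 + q) * s) + (- s / (1 + q)) ^+ 2 * q =
          - (s ^+ 2 * (2 + q) / (1 + q) ^+ 2) by field.
rewrite oppr_ge0 pmulr_lle0 ?invr_gt0 ?exprn_gt0 ?ltr_pwDl// => H.
have q2 : 0 < 2 + q by rewrite ltr_pwDl.
by move: H; rewrite pmulr_lle0// => s2; rewrite -sqrf_eq0 eq_le s2 sqr_ge0.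
Qed.

Lemma continuous_qform n (A : 'M[R]_n) : continuous (qform A).
Proof.
move=> v; rewrite (_ : qform A = fun v => \sum_i \sum_j v 0 i * A i j * v 0 j).
  have FF := nbhs_filter v; apply: cvg_sumr => i; apply: cvg_sumr => j.
  apply: cvgM; last exact: coord_continuous.
  by apply: cvgM; [exact: coord_continuous|exact: cvg_cst].
by apply/funext => u; exact: qform_sum.
Qed.

Lemma compact_sphere n : compact [set v : 'rV[R]_n | dotmx v v = 1].
Proof.
have cB : compact [set v : 'rV[R]_n | forall i, `[-1, 1]%classic (v ord0 i)].
  by apply: (@rV_compact R n (fun=> `[-1, 1]%classic)) => _;
    exact: segment_compact.
apply: subclosed_compact cB _.
  rewrite (_ : [set _ | _] = qform 1%:M @^-1` [set 1]).
    apply: closed_comp; last exact: closed_eq.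
    by move=> v _; exact: continuous_qform.
  by apply/seteqP; split => v /=; rewrite qform1.
move=> v /= v1 i; rewrite /= in_itv/= -ler_norml -(expr_le1 (n := 2))//.
rewrite real_normK ?num_real// -v1 dotmxE (bigD1 i)//= -expr2 lerDl.
by rewrite sumr_ge0// => j _; rewrite -expr2 sqr_ge0.
Qed.

(* The Rayleigh quotient attains its maximum on the sphere, and a maximizer is
   isotropic for the psd matrix [a%:M - A]. *)
Lemma sym_max_eigen n (A : 'M[R]_n.+1) : A^T = A ->
  exists v a, [/\ dotmx v v = 1, v *m A = a *: v &
                 forall u, qform A u <= a * dotmx u u].
Proof.
move=> sA; have [||v] := @EVT_max_rV _ _ (qform A) _ _ (@compact_sphere n.+1).
- exists (delta_mx 0 0) => /=.
  by rewrite /dotmx trmx_delta mul_delta_mx mxE.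
- by apply: continuous_subspaceT => u; exact: continuous_qform.
rewrite inE/= => v1 vmax; exists v, (qform A v).
have le u : qform A u <= qform A v * dotmx u u.
  have [->|u0] := eqVneq u 0.
    by rewrite qformE /dotmx !mul0mx mxE mulr0.
  have un : 0 < dotmx u u by rewrite lt_neqAle dotmxvv_ge0 eq_sym dotmxvv_eq0
    u0.
  have /vmax : (Num.sqrt (dotmx u u))^-1 *: u \in [set v | dotmx v v = 1].
    rewrite inE/= dotmxZl dotmxZr mulrA -expr2 exprVn sqr_sqrtr ?ltW//.
    by rewrite mulVf ?gt_eqF.
  by rewrite qformZ exprVn sqr_sqrtr ?(ltW un)// mulrC ler_pdivrMr.
split=> //.
have pB : psd (qform A v *: 1%:M - A).
  split; first by rewrite linearB linearZ/= trmx1 sA.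
  move=> u; rewrite -/(qform _ u) qformE mulmxBr -scalemxAr mulmx1.
  by rewrite dotmxBl dotmxZl subr_ge0 le.
have /(psd_isotropic pB) : qform (qform A v *: 1%:M - A) v = 0.
  rewrite qformE mulmxBr -scalemxAr mulmx1 dotmxBl dotmxZl v1 mulr1.
  by rewrite subrr.
by rewrite mulmxBr -scalemxAr mulmx1 => /eqP; rewrite subr_eq0 => /eqP.
Qed.

End RealMatrices.

(** * Spectral theorem, square roots and operator norms *)

Section Spectral.
Context (R : realType).
Implicit Types (n k l : nat).

(* The Householder reflection exchanging [e_0] and [v]. *)
Lemma reflection_row n (v : 'rV[R]_n.+1) : dotmx v v = 1 ->
  exists H : 'M[R]_n.+1, [/\ H^T = H, H *m H = 1%:M & delta_mx 0 0 *m H = v].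
Proof.
move=> v1; pose e : 'rV[R]_n.+1 := delta_mx 0 0.
have ee : dotmx e e = 1 by rewrite /dotmx trmx_delta mul_delta_mx mxE.
have [w wE] : {w | w = v - e} by exists (v - e).
have [w0|w0] := eqVneq w 0.
  exists 1%:M; rewrite trmx1 !mulmx1; split => //.
  by apply/esym/eqP; rewrite -subr_eq0 -/e -wE w0.
pose s := dotmx w w.
have s0 : s != 0 by rewrite dotmxvv_eq0.
have ew : e *m w^T = (- s / 2)%:M.
  apply/matrixP => i j; rewrite !ord1 -/(dotmx e w) [RHS]mxE eqxx mulr1n /s wE.
  by rewrite !(dotmxBl, dotmxBr) v1 ee (dotmxC e v); field.
have ww : w *m w^T = s%:M.
  by apply/matrixP => i j; rewrite !ord1 -/(dotmx w w) [RHS]mxE eqxx mulr1n.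
exists (1%:M - (2 / s) *: (w^T *m w)); split.
- by rewrite linearB linearZ/= trmx1 trmx_mul trmxK.
- have WW : w^T *m w *m (w^T *m w) = s *: (w^T *m w).
    by rewrite mulmxA -(mulmxA w^T) ww mul_mx_scalar -scalemxAl.
  rewrite mulmxBl mul1mx mulmxBr mulmx1 -scalemxAl -scalemxAr WW !scalerA.
  rewrite (_ : 2 / s * (2 / s) * s = 2 / s + 2 / s); last by field.
  by rewrite scalerDl opprB addrK subrK.
- rewrite mulmxBr mulmx1 -scalemxAr mulmxA ew mul_scalar_mx scalerA.
  rewrite (_ : 2 / s * (- s / 2) = -1) ?scaleN1r ?opprK; last by field.
  by rewrite wE -/e addrC subrK.
Qed.

(** With row vectors, the rows of [Q] are orthonormal eigenvectors and [d] lists their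
    eigenvalues. *)
Definition orth_diagonalizable n (A : 'M[R]_n) : Prop :=
  exists (Q : 'M[R]_n) (d : 'rV[R]_n),
    Q *m Q^T = 1%:M /\ A = Q^T *m diag_mx d *m Q.

Lemma orth_diagonalizable_conj n (A H : 'M[R]_n) : H^T = H -> H *m H = 1%:M ->
  orth_diagonalizable (H *m A *m H) -> orth_diagonalizable A.
Proof.
move=> sH HH [Q [d [QQ AE]]]; exists (Q *m H), d; split.
  by rewrite trmx_mul sH mulmxA -(mulmxA Q) HH mulmx1.
have -> : A = H *m (H *m A *m H) *m H.
  by rewrite !mulmxA HH mul1mx -mulmxA HH mulmx1.
by rewrite AE trmx_mul sH !mulmxA.
Qed.

(** By symmetry the first column vanishes off the diagonal as the first row does, so [B] is block
    diagonal and a diagonalization of its lower block extends by a 1. *)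
Lemma orth_diagonalizable_block n (B : 'M[R]_(1 + n)) a : B^T = B ->
  row 0 B = a *: delta_mx 0 0 -> orth_diagonalizable (drsubmx B) ->
  orth_diagonalizable B.
Proof.
move=> sB rB [Q [d [QQ dE]]].
have Bul : ulsubmx B = a%:M.
  apply/matrixP => i j; rewrite !ord1 !mxE eqxx mulr1n.
  have := congr1 (fun r : 'rV_(1 + n) => r 0 0) rB.
  rewrite !mxE eqxx mulr1 => <-.
  by congr (B _ _); apply/val_inj.
have Bur : ursubmx B = 0.
  apply/matrixP => i j; rewrite !ord1 !mxE.
  have := congr1 (fun r : 'rV_(1 + n) => r 0 (rshift 1 j)) rB.
  rewrite !mxE mulr0 => <-.
  by congr (B _ _); apply/val_inj.
have Bdl : dlsubmx B = 0 by rewrite -[dlsubmx _]trmxK trmx_dlsub sB Bur trmx0.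
exists (block_mx 1%:M 0 0 Q), (row_mx a%:M d).
have tr : (block_mx 1%:M 0 0 Q : 'M[R]_(1 + n))^T = block_mx 1%:M 0 0 Q^T.
  by rewrite tr_block_mx trmx1 !trmx0.
split.
  rewrite tr mulmx_block.
  by rewrite !mul1mx !mul0mx !mulmx0 !addr0 !add0r QQ -scalar_mx_block.
rewrite tr diag_mx_row (_ : diag_mx a%:M = a%:M); last first.
  by apply/matrixP => i j; rewrite !ord1 !mxE eqxx !mulr1n.
rewrite !mulmx_block !mul1mx !mul0mx !mulmx0 !mulmx1 !addr0 !add0r.
by rewrite -[LHS]submxK Bul Bur Bdl dE !mul0mx.
Qed.

(** Induction on the size: a reflection carries a maximizer of the Rayleigh quotient to the first
    basis vector, which splits off a smaller symmetric block. *)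
Lemma spectral_real n (A : 'M[R]_n) : A^T = A -> orth_diagonalizable A.
Proof.
elim: n A => [|n IH] A sA.
  by exists 1%:M, 0; split; apply/matrixP => -[].
have [v [a [v1 vA _]]] := sym_max_eigen sA.
have [H [sH HH eH]] := reflection_row v1.
apply: (orth_diagonalizable_conj sH HH); set B := H *m A *m H.
have sB : B^T = B by rewrite /B !trmx_mul sH sA mulmxA.
apply: (@orth_diagonalizable_block n B a) => //.
  by rewrite rowE /B !mulmxA eH vA -scalemxAl -eH -mulmxA HH mulmx1.
by apply: IH; rewrite trmx_drsub sB.
Qed.

Lemma psd_sqrt_exists n (A : 'M[R]_n) : psd A ->
  exists S, psd S /\ S *m S = A.
Proof.
move=> [sA A0]; have [Q [d [QQ AE]]] := spectral_real sA.
(* [d 0 i] is the value of the form of [A] at the eigenvector [row i Q]. *)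
have d0 i : 0 <= d 0 i.
  have := A0 (row i Q); rewrite -/(qform A _) qformE AE !mulmxA -row_mul QQ.
  rewrite rowE mulmx1 dotmx_mul -!rowE -row_mul QQ row1 dotmxE (bigD1 i)//=.
  rewrite !mxE !eqxx /= mulr1n mulr1 big1 ?addr0// => j ji.
  by rewrite !mxE eqxx eq_sym (negbTE ji) mulr0.
pose D := diag_mx (map_mx Num.sqrt d).
exists (Q^T *m D *m Q); split; last first.
  rewrite !mulmxA -(mulmxA _ Q) QQ mulmx1 AE -(mulmxA Q^T); congr (_ *m _ *m _).
  apply/matrixP => i j; rewrite mul_diag_mx !mxE.
  by case: eqP => [->|_]; rewrite ?mulr1n ?mulr0n ?mulr0// -expr2 sqr_sqrtr.
split=> [|v]; first by rewrite !trmx_mul trmxK tr_diag_mx mulmxA.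
rewrite -/(qform _ v) -{2}[Q]trmxK -qform_conj qform_sum sumr_ge0// => i _.
rewrite (bigD1 i)//= big1 ?addr0 => [|j ji].
  rewrite !mxE eqxx mulr1n mulrAC mulr_ge0 ?sqrtr_ge0//.
  by rewrite -expr2 sqr_ge0.
by rewrite !mxE eq_sym (negbTE ji) mulr0 mul0r.
Qed.

Lemma sqrtmxP n (A : 'M[R]_n) : psd A ->
  psd (sqrtmx A) /\ sqrtmx A *m sqrtmx A = A.
Proof. by move=> /psd_sqrt_exists; exact: xgetPex. Qed.

(** The sign of [c] matters when there is no eigenvalue, as in dimension 0: the supremum of the
    empty set is 0. *)
Lemma lambda_max_le n (A : 'M[R]_n) c : 0 <= c ->
  (forall u, qform A u <= c * dotmx u u) -> lambda_max A <= c.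
Proof.
move=> c0 Ac; rewrite /lambda_max; set E := [set _ | _].
have [->|/set0P E0] := eqVneq E set0; first by rewrite sup0.
apply: ge_sup => // a /eigenvalueP[v vA v0].
have := Ac v; rewrite qformE vA dotmxZl ler_pM2r// lt_neqAle dotmxvv_ge0.
by rewrite eq_sym dotmxvv_eq0 v0.
Qed.

Lemma qform_lambda_max n (A : 'M[R]_n) u : A^T = A ->
  qform A u <= lambda_max A * dotmx u u.
Proof.
case: n A u => [|n] A u sA.
  by rewrite qform_sum dotmxE !big_ord0 mulr0.
have [v [a [v1 vA leA]]] := sym_max_eigen sA.
have v0 : v != 0 by rewrite -dotmxvv_eq0 v1 oner_eq0.
apply: le_trans (leA u) _; rewrite ler_wpM2r ?dotmxvv_ge0//.
apply: ub_le_sup; last by apply/eigenvalueP; exists v.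
(* The supremum is an upper bound only for a bounded set: [a] bounds every eigenvalue. *)
exists a => b /eigenvalueP[w wA w0].
have := leA w; rewrite qformE wA dotmxZl ler_pM2r// lt_neqAle dotmxvv_ge0.
by rewrite eq_sym dotmxvv_eq0 w0.
Qed.

Lemma lambda_max_ge0 n (A : 'M[R]_n) : (forall v, 0 <= qform A v) ->
  0 <= lambda_max A.
Proof.
move=> A0; rewrite /lambda_max; set E := [set _ | _].
(* For a set that is empty or unbounded above, [sup] takes the default value 0. *)
have [hE|/sup_out ->//] := pselect (has_sup E).
have [[a Ea] _] := hE; apply: le_trans (sup_upper_bound hE Ea).
have /eigenvalueP[w wA w0] := Ea; have := A0 w;
  rewrite qformE wA dotmxZl pmulr_lge0// lt_neqAle dotmxvv_ge0.
by rewrite eq_sym dotmxvv_eq0 w0.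
Qed.

Lemma opnorm_ge0 n k (M : 'M[R]_(n, k)) : 0 <= opnorm M.
Proof. exact: sqrtr_ge0. Qed.

Lemma sqr_opnorm n k (M : 'M[R]_(n, k)) :
  opnorm M ^+ 2 = lambda_max (M *m M^T).
Proof.
rewrite sqr_sqrtr// lambda_max_ge0// => v; rewrite qform_gram.
exact: dotmxvv_ge0.
Qed.

Lemma opnorm_mul n k (M : 'M[R]_(n, k)) u :
  dotmx (u *m M) (u *m M) <= opnorm M ^+ 2 * dotmx u u.
Proof.
by rewrite -qform_gram sqr_opnorm qform_lambda_max// trmx_mul trmxK.
Qed.

(* With [x = u M^T M], [0 <= |x - K u|^2] gives [|u M^T|^2 <= K |u|^2]. *)
Lemma opnorm_mul_tr n k (M : 'M[R]_(n, k)) u :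
  dotmx (u *m M^T) (u *m M^T) <= opnorm M ^+ 2 * dotmx u u.
Proof.
set K := opnorm M ^+ 2; set s := dotmx _ _.
pose x := u *m M^T *m M.
have sE : s = dotmx x u by rewrite /x dotmx_mul.
have xK : dotmx x x <= K * s by exact: opnorm_mul.
have := dotmxvv_ge0 (x - K *: u).
rewrite !(dotmxBl, dotmxBr, dotmxZl, dotmxZr) (dotmxC u x) -sE => H.
have [K0|K0] := eqVneq K 0.
  move: xK; rewrite K0 !mul0r => xx.
  have /eqP : dotmx x x = 0 by apply/eqP; rewrite eq_le xx dotmxvv_ge0.
  by rewrite dotmxvv_eq0 sE => /eqP ->; rewrite /dotmx mul0mx mxE.
have Kp : 0 < K by rewrite lt_neqAle eq_sym K0 sqr_ge0.
rewrite -(ler_pM2l Kp); nra.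
Qed.

Lemma opnorm_le n k (M : 'M[R]_(n, k)) c : 0 <= c ->
  (forall u, dotmx (u *m M) (u *m M) <= c ^+ 2 * dotmx u u) -> opnorm M <= c.
Proof.
move=> c0 H; rewrite -(@ler_pXn2r _ 2)// ?nnegrE ?opnorm_ge0// sqr_opnorm.
by apply: lambda_max_le; rewrite ?sqr_ge0// => u; rewrite qform_gram.
Qed.

Lemma sqr_frobnorm n k (M : 'M[R]_(n, k)) :
  frobnorm M ^+ 2 = \sum_i \sum_j M i j ^+ 2.
Proof.
have E : \tr (M *m M^T) = \sum_i \sum_j M i j ^+ 2.
  by apply: eq_bigr => i _; rewrite mxE; apply: eq_bigr => j _;
    rewrite mxE expr2.
rewrite sqr_sqrtr ?E// sumr_ge0// => i _; rewrite sumr_ge0// => j _.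
exact: sqr_ge0.
Qed.

Lemma unitmx_qform n (M : 'M[R]_n) :
  (forall v, v != 0 -> 0 < qform M v) -> M \in unitmx.
Proof.
move=> M0; rewrite -row_free_unit -kermx_eq0; apply/eqP/row_matrixP => i.
rewrite row0; apply/eqP/negPn/negP => /M0.
have /sub_kermxP : (row i (kermx M) <= kermx M)%MS by exact: row_sub.
by rewrite qformE => ->; rewrite /dotmx mul0mx mxE ltxx.
Qed.

Lemma sqrtmx_unit n (A : 'M[R]_n) : psd A -> A \in unitmx ->
  sqrtmx A \in unitmx.
Proof.
by move=> /sqrtmxP[_ {1}<-]; rewrite unitmx_mul andbb.
Qed.

Lemma qform_sqrtmx n (A : 'M[R]_n) v : psd A ->
  qform A v = dotmx (v *m sqrtmx A) (v *m sqrtmx A).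
Proof.
by move=> /sqrtmxP[[sS _] SS]; rewrite -{1}SS -{2}sS qform_gram.
Qed.

(** Trades the inverse for an inequality linear in [M]. Each direction expands a square: |x - c d|^2
    with d = v M^{1/2} and x = d M^{-1}, for which x.d = |v|^2; and |u - c v|^2 with u = v M^{-1},
    for which the assumption reads |u|^2 <= c u.v. *)
Lemma opnorm_invP n (M : 'M[R]_n) (c : R) : psd M -> 0 < c ->
  (M \in unitmx /\ opnorm (invmx M) <= c) <->
  (forall v, dotmx v v <= c * qform M v).
Proof.
move=> pM c0; split=> [[uM le] v|H].
  have [[sS _] SS] := sqrtmxP pM.
  have uS := sqrtmx_unit pM uM.
  pose d := v *m sqrtmx M; pose x := d *m invmx M.
  have xx : dotmx x x <= c ^+ 2 * dotmx d d.
    apply: le_trans (opnorm_mul _ _) _; rewrite ler_wpM2r ?dotmxvv_ge0//.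
    by rewrite ler_pXn2r ?nnegrE ?opnorm_ge0// ltW.
  have SMS : sqrtmx M *m invmx M *m sqrtmx M = 1%:M.
    rewrite -[LHS](mulmxK uS) -(mulmxA _ (sqrtmx M) (sqrtmx M)) SS.
    by rewrite mulmxKV// mulmxV.
  have vx : dotmx x d = dotmx v v.
    by rewrite /x /d dotmxC dotmx_mul sS -!mulmxA (mulmxA (sqrtmx M)) SMS
      mulmx1.
  rewrite (qform_sqrtmx _ pM) -/d.
  have := dotmxvv_ge0 (x - c *: d).
  rewrite !(dotmxBl, dotmxBr, dotmxZl, dotmxZr) (dotmxC d x) vx => H.
  rewrite -(ler_pM2l c0); nra.
have uM : M \in unitmx.
  apply: unitmx_qform => v v0; rewrite -(pmulr_rgt0 _ c0).
  by apply: lt_le_trans (H v);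
    rewrite lt_neqAle eq_sym dotmxvv_eq0 v0 dotmxvv_ge0.
split=> //; apply: opnorm_le; first exact: ltW.
move=> v; pose u := v *m invmx M.
have vE : u *m M = v by rewrite /u mulmxKV.
have := H u; rewrite qformE vE -/u => Hu.
have := dotmxvv_ge0 (u - c *: v).
rewrite !(dotmxBl, dotmxBr, dotmxZl, dotmxZr) (dotmxC u v); nra.
Qed.

End Spectral.

(** * Least squares at a fixed design *)

Section Design.
Context (R : realType) (n m p : nat).
Variables (F : 'M[R]_(n, m + p)) (Delta : 'M[R]_(m, m + p)).
Hypothesis n0 : (0 < n)%N.

Definition gram : 'M[R]_(m + p) := n%:R^-1 *: (F^T *m F).

Definition gram_l : 'M[R]_m := n%:R^-1 *: ((lsubmx F)^T *m lsubmx F).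

(** [y *m lscoef] is the transposed vector of least squares coefficients. [F] has [m + p] columns
    because the derivative of the fit lives in the larger space, but only the first [m] enter the
    fit. *)
Definition lscoef : 'M[R]_(n, m) := n%:R^-1 *: (lsubmx F *m invmx gram_l).

(* [y *m deriv_smoother] lists the values at the design points of the derivative
   of the least squares fit of [y]. *)
Definition deriv_smoother : 'M[R]_n := lscoef *m Delta *m F^T.

Let nR : (n%:R : R) != 0. Proof. by rewrite pnatr_eq0 -lt0n. Qed.
Let nRp : 0 < (n%:R : R). Proof. by rewrite ltr0n. Qed.

Lemma qform_gram_emp (v : 'rV[R]_(m + p)) : dotmx (v *m F^T) (v *m F^T) = n%:R
  * qform gram v.
Proof. by rewrite /gram qformZm mulrA divff// mul1r qform_gram_tr. Qed.

Lemma lsubmx_mul_row_mx0 k (c : 'M[R]_(k, m)) :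
  row_mx c (0 : 'M[R]_(k, p)) *m F^T = c *m (lsubmx F)^T.
Proof.
by rewrite -{1}[F]hsubmxK tr_row_mx mul_row_col mul0mx addr0.
Qed.

Lemma qform_gram_l_emp (c : 'rV[R]_m) :
  dotmx (c *m (lsubmx F)^T) (c *m (lsubmx F)^T) = n%:R * qform gram_l c.
Proof.
by rewrite /gram_l qformZm mulrA divff// mul1r qform_gram_tr.
Qed.

(** Padding with zeros embeds the smaller space into the larger one, so bounds on [gram] restrict to
    [gram_l]. *)
Lemma qform_gram_l c : qform gram_l c = qform gram (row_mx c 0).
Proof.
by apply: (mulfI nR); rewrite -qform_gram_l_emp -qform_gram_emp
  lsubmx_mul_row_mx0.
Qed.

Lemma gram_l_sym : gram_l^T = gram_l.
Proof. by rewrite /gram_l linearZ/= trmx_mul trmxK. Qed.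

Hypothesis gU : gram_l \in unitmx.

(** Least squares recovers an element of the fitted space from its values at the design points.
    Hence the smoother acts on b through b - b_m only, up to the exact derivative of b_m. *)
Lemma lscoefK k (c : 'M[R]_(k, m)) : c *m (lsubmx F)^T *m lscoef = c.
Proof.
rewrite -[RHS](mulmxK gU) /lscoef; move: (invmx _) => V.
by rewrite /gram_l -!scalemxAr -scalemxAl !mulmxA.
Qed.

(** Up to the factor sigma^2, this is the covariance of the coefficients given the design. *)
Lemma lscoef_gram : lscoef^T *m lscoef = n%:R^-1 *: invmx gram_l.
Proof.
have -> : lscoef^T = n%:R^-1 *: (invmx gram_l *m (lsubmx F)^T).
  by rewrite /lscoef [LHS]linearZ/= trmx_mul trmx_inv gram_l_sym.
by rewrite -scalemxAl lscoefK.
Qed.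

Lemma deriv_smootherK (c : 'rV[R]_m) : c *m (lsubmx F)^T *m deriv_smoother = c
  *m Delta *m F^T.
Proof. by rewrite /deriv_smoother !mulmxA lscoefK. Qed.

(* The fitted values are the orthogonal projection of [y]. *)
Lemma qform_lscoef_le (y : 'rV[R]_n) :
  n%:R * qform gram_l (y *m lscoef) <= dotmx y y.
Proof.
pose t := y *m lscoef; pose z := t *m (lsubmx F)^T.
have yz : dotmx y z = dotmx z z.
  rewrite [RHS]qform_gram_l_emp /z dotmxC dotmx_mul trmxK dotmxC qformE.
  rewrite -dotmxZl; congr dotmx.
  rewrite /t -mulmxA /lscoef -scalemxAl mulmxKV// -scalemxAr scalerA.
  by rewrite divff// scale1r.
rewrite -qform_gram_l_emp -/t -/z.
have := dotmxvv_ge0 (y - z).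
rewrite !(dotmxBl, dotmxBr, dotmxZl, dotmxZr) (dotmxC z y) yz; lra.
Qed.

Lemma deriv_smoother_sq (y : 'rV[R]_n) :
  dotmx (y *m deriv_smoother) (y *m deriv_smoother) =
  n%:R * qform gram (y *m lscoef *m Delta).
Proof. by rewrite /deriv_smoother !mulmxA qform_gram_emp. Qed.

(** The bound available on Lambda alone. [L] bounds [gram] from above and [L / C] bounds it from
    below, so [L] cancels and [C] remains: with t the fitted coefficients, gram(t Delta) <= L
    |Delta|^2 |t|^2 <= C |Delta|^2 gram_l(t). *)
Lemma deriv_smoother_le (L C : R) (y : 'rV[R]_n) : 0 <= L ->
  (forall v, qform gram v <= L * dotmx v v) ->
  (forall v, L * dotmx v v <= C * qform gram v) -> 0 <= C ->
  dotmx (y *m deriv_smoother) (y *m deriv_smoother) <=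
    C * opnorm Delta ^+ 2 * dotmx y y.
Proof.
move=> L0 gL Lg C0; rewrite deriv_smoother_sq; set t := y *m lscoef.
have h1 : qform gram (t *m Delta) <= L * (opnorm Delta ^+ 2 * dotmx t t).
  by apply: le_trans (gL _) _; rewrite ler_wpM2l// opnorm_mul.
have h2 : L * dotmx t t <= C * qform gram_l t.
  apply: le_trans (_ : L * dotmx (row_mx t 0) (row_mx t (0 : 'M[R]_(1, p))) <=
    _).
    by rewrite /dotmx tr_row_mx mul_row_col trmx0 mulmx0 addr0.
  by rewrite qform_gram_l.
have h3 : n%:R * qform gram_l t <= dotmx y y by exact: qform_lscoef_le.
apply: le_trans (_ : n%:R * (opnorm Delta ^+ 2 * (C * qform gram_l t)) <= _).
  rewrite ler_pM2l//; apply: le_trans h1 _.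
  by rewrite mulrCA ler_wpM2l ?sqr_ge0.
rewrite [leLHS](_ : _ = C * opnorm Delta ^+ 2 * (n%:R * qform gram_l t)).
  by rewrite ler_wpM2l// mulr_ge0 ?sqr_ge0.
ring.
Qed.

Variables (P : 'M[R]_(m + p)).
Hypothesis pP : psd P.
Let Pl := ulsubmx P.
Hypothesis PlU : Pl \in unitmx.
Hypothesis PG : forall v, `|qform gram v - qform P v| <= 1 / 2 * qform P v.

Lemma qform_ulsubmx c : qform Pl c = qform P (row_mx c 0).
Proof.
rewrite /qform -[P in RHS]submxK mul_row_block !mul0mx !addr0.
by rewrite tr_row_mx trmx0 mul_row_col mulmx0 addr0.
Qed.

Lemma psd_ulsubmx : psd Pl.
Proof.
split; first by rewrite /Pl trmx_ulsub pP.1.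
by move=> c; rewrite -/(qform _ c) qform_ulsubmx; exact: pP.2.
Qed.

(** The coordinates [t *m sqrtmx Pl] turn the form of [Pl] into the Euclidean one, and likewise for
    [P]; in them the map from [t] to [t *m Delta] becomes multiplication by [Df^T]. *)
Let Df := sqrtmx P *m Delta^T *m invmx (sqrtmx Pl).

Lemma gram_le_P v : qform gram v <= 3 / 2 * qform P v.
Proof. by have := PG v; rewrite ler_norml => /andP[_]; lra. Qed.

Lemma Pl_le_gram c : qform Pl c <= 2 * qform gram_l c.
Proof.
rewrite qform_ulsubmx qform_gram_l; have := PG (row_mx c 0).
by rewrite ler_norml => /andP[+ _]; lra.
Qed.

Lemma deriv_smoother_le_Df (y : 'rV[R]_n) :
  dotmx (y *m deriv_smoother) (y *m deriv_smoother) <=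
    3 * opnorm Df ^+ 2 * dotmx y y.
Proof.
rewrite deriv_smoother_sq; set t := y *m lscoef.
have uS : sqrtmx Pl \in unitmx by apply: sqrtmx_unit => //; exact: psd_ulsubmx.
have [[sS _] _] := sqrtmxP pP.
have [[sSl _] _] := sqrtmxP psd_ulsubmx.
have h1 : qform P (t *m Delta) <= opnorm Df ^+ 2 * qform Pl t.
  rewrite !qform_sqrtmx//; last exact: psd_ulsubmx.
  have -> : t *m Delta *m sqrtmx P = t *m sqrtmx Pl *m Df^T.
    by rewrite /Df !trmx_mul trmxK trmx_inv sS sSl !mulmxA mulmxK.
  exact: opnorm_mul_tr.
have h2 := gram_le_P (t *m Delta).
have h3 := Pl_le_gram t.
have h4 : n%:R * qform gram_l t <= dotmx y y by exact: qform_lscoef_le.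
have D0 : 0 <= opnorm Df ^+ 2 by exact: sqr_ge0.
apply: le_trans (_ : 3 * opnorm Df ^+ 2 * (n%:R * qform gram_l t) <= _).
  rewrite mulrCA ler_pM2l//; apply: le_trans h2 _.
  move: (opnorm Df ^+ 2) D0 h1 h3 => K K0; nra.
by rewrite ler_wpM2l// mulr_ge0.
Qed.

(* With [u = v G^-1] and [S^2 = Pl <= 2 G], AM-GM on [v u^T = (v S^-1)(u S)^T]
   gives [v G^-1 v^T <= 2 |v S^-1|^2]. *)
Lemma gram_l_inv_le (v : 'rV[R]_m) :
  qform (invmx gram_l) v <=
    2 * dotmx (v *m invmx (sqrtmx Pl)) (v *m invmx (sqrtmx Pl)).
Proof.
have uS : sqrtmx Pl \in unitmx by apply: sqrtmx_unit => //; exact: psd_ulsubmx.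
have [[sSl _] _] := sqrtmxP psd_ulsubmx.
pose u := v *m invmx gram_l.
set a := v *m invmx _.
pose b := u *m sqrtmx Pl.
have ab : dotmx a b = dotmx u v.
  by rewrite /a /b dotmx_mul trmx_inv sSl mulmxK// dotmxC.
have bb : dotmx b b <= 2 * qform gram_l u.
  by rewrite /b -qform_sqrtmx//; [exact: Pl_le_gram|exact: psd_ulsubmx].
have uv : qform gram_l u = dotmx u v by rewrite qformE /u mulmxKV// dotmxC.
rewrite qformE -/u.
have := dotmxvv_ge0 (2 *: a - b).
rewrite !(dotmxBl, dotmxBr, dotmxZl, dotmxZr) (dotmxC b a); lra.
Qed.

(** Column [i] of the smoother has squared norm v G^{-1} v^T / n, where G is [gram_l] and v is row
    [i] of [F *m Delta^T], the derivatives at that design point. Bounding G^{-1} alone leaves a sum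
    over the design points, whose expectation is explicit. *)
Lemma deriv_smoother_frob :
  \sum_i \sum_j deriv_smoother j i ^+ 2 <=
    2 / n%:R * \sum_i \sum_j (F *m Delta^T *m invmx (sqrtmx Pl)) i j ^+ 2.
Proof.
rewrite mulr_sumr; apply: ler_sum => i _.
pose v := row i (F *m Delta^T).
have -> : \sum_j (F *m Delta^T *m invmx (sqrtmx Pl)) i j ^+ 2 =
          dotmx (v *m invmx (sqrtmx Pl)) (v *m invmx (sqrtmx Pl)).
  by rewrite dotmxE -row_mul; apply: eq_bigr => j _; rewrite [in RHS]mxE expr2.
have -> : \sum_j deriv_smoother j i ^+ 2 = n%:R^-1 * qform (invmx gram_l) v.
  pose w := v *m lscoef^T.
  have -> : \sum_j deriv_smoother j i ^+ 2 = dotmx w w.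
    rewrite dotmxE; apply: eq_bigr => j _; rewrite expr2.
    suff -> : w 0 j = deriv_smoother j i by [].
    have -> : w = row i deriv_smoother^T.
      by rewrite /w /v -row_mul /deriv_smoother !trmx_mul trmxK mulmxA.
    by rewrite !mxE.
  rewrite -qform_gram trmxK lscoef_gram qformZm.
  by congr (_ * _).
rewrite [leLHS]mulrC [leRHS]mulrAC ler_pM2r ?invr_gt0//.
exact: gram_l_inv_le.
Qed.

End Design.

(** * Independence and expectations *)

Section Independence.
Context (R : realType) (d : measure_display) (T : measurableType d).
Context (P : probability T R).
Local Open Scope ereal_scope.

Definition independent_rv (U V : T -> R) : Prop :=
  forall A B : set R, measurable A -> measurable B ->
    P (U @^-1` A `&` V @^-1` B) = P (U @^-1` A) * P (V @^-1` B).

(** Independence is agreement on rectangles, which determines the product measure. *)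
Lemma joint_law (U V : {mfun T >-> R}) : independent_rv U V ->
  forall A : set (R * R), measurable A ->
    (distribution P U \x distribution P V) A =
    pushforward P (fun w => (U w, V w)) A.
Proof.
move=> UV A mA.
have mUV : measurable_fun [set: T] (fun w => (U w, V w)).
  exact: measurable_fun_pair.
pose W : {mfun T >-> (R * R)%type} :=
  HB.pack (fun w => (U w, V w)) (isMeasurableFun.Build _ _ _ _ _ mUV).
by apply: (product_measure_unique (m' := distribution P W)) => //.
Qed.

Lemma ge0_integral_joint (U V : {mfun T >-> R}) (h : R * R -> \bar R) :
  independent_rv U V -> measurable_fun [set: R * R] h -> (forall z, 0 <= h z) ->
  \int[P]_w h (U w, V w) =
  \int[distribution P U \x distribution P V]_z h z.
Proof.
move=> UV mh h0.
have mUV : measurable_fun [set: T] (fun w => (U w, V w)).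
  exact: measurable_fun_pair.
rewrite (eq_measure_integral (pushforward P (fun w => (U w, V w)))); last first.
  by move=> A mA _; exact: joint_law.
by rewrite ge0_integral_pushforward.
Qed.

Lemma eq_ge0_integral_joint (U V U' V' : {mfun T >-> R}) (h : R * R -> \bar R) :
  independent_rv U V -> independent_rv U' V' ->
  (forall A, measurable A -> P (U @^-1` A) = P (U' @^-1` A)) ->
  (forall A, measurable A -> P (V @^-1` A) = P (V' @^-1` A)) ->
  measurable_fun [set: R * R] h -> (forall z, 0 <= h z) ->
  \int[P]_w h (U w, V w) = \int[P]_w h (U' w, V' w).
Proof.
move=> UV UV' UU VV mh h0; rewrite !ge0_integral_joint//.
apply: eq_measure_integral => A mA _.
apply: product_measure_unique => // B C mB mC.
apply: (eq_trans (product_measure1E (distribution P U') (distribution P V') mB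
  mC)).
by congr (_ * _); apply/esym; [exact: UU|exact: VV].
Qed.

(** Tonelli for the absolute value of the product gives integrability, which then allows Fubini
    under the product of the two laws. *)
Lemma integrable_mul_indep (U V : {mfun T >-> R}) : independent_rv U V ->
  P.-integrable setT (EFin \o U) -> P.-integrable setT (EFin \o V) ->
  P.-integrable setT (EFin \o (fun w => U w * V w)%R) /\
  (\int[P]_w (U w * V w) = \int[P]_w U w * \int[P]_w V w)%R.
Proof.
move=> UV iU iV.
set mu := distribution P U; set nu := distribution P V.
have iU' : mu.-integrable setT (EFin \o id).
  by apply: integrable_pushforward => //; exact/measurable_EFinP.
have iV' : nu.-integrable setT (EFin \o id).
  by apply: integrable_pushforward => //; exact/measurable_EFinP.
have mUV : measurable_fun setT (EFin \o (fun w => U w * V w)%R).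
  by apply/measurable_EFinP; exact: measurable_funM.
have mm : measurable_fun [set: R * R] (fun z : R * R => (z.1 * z.2)%:E).
  by apply/measurable_EFinP; exact: measurable_funM.
have iUV : P.-integrable setT (EFin \o (fun w => U w * V w)%R).
  apply/integrableP; split=> //.
  rewrite (ge0_integral_joint (h := fun z => `|(z.1 * z.2)%:E|)) //; last first.
    exact: measurableT_comp.
  rewrite fubini_tonelli1//; last exact: measurableT_comp.
  have /integrableP[_ iUoo] := iU'; have /integrableP[_ iVoo] := iV'.
  rewrite (eq_integral (fun x : R => `|x%:E| * \int[nu]_y `|y%:E|)); last first.
    move=> x _; rewrite /fubini_F -ge0_integralZl//;
      last exact: measurableT_comp.
    by apply: eq_integral => y _; rewrite /= normrM EFinM.
  rewrite ge0_integralZr//; last 2 first.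
  - exact: measurableT_comp.
  - exact: integral_ge0.
  by rewrite lte_mul_pinfty ?integral_ge0// ge0_fin_numE ?integral_ge0.
split=> //.
have imm : (mu \x nu).-integrable setT (fun z : R * R => (z.1 * z.2)%:E).
  apply/integrableP; split=> //.
  have /integrableP[_] := iUV; apply: le_lt_trans.
  rewrite (ge0_integral_joint (h := fun z => `|(z.1 * z.2)%:E|)) //.
  exact: measurableT_comp.
have mUV2 : measurable_fun [set: T] (fun w => (U w, V w)).
  exact: measurable_fun_pair.
have eU : \int[mu]_x x%:E = \int[P]_w (U w)%:E.
  by rewrite integral_pushforward.
have eV : \int[nu]_x x%:E = \int[P]_w (V w)%:E.
  by rewrite integral_pushforward.
rewrite /Rintegral -fineM; last 2 first.
- exact: integrable_fin_num iU.
- exact: integrable_fin_num iV.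
congr fine; rewrite -eU -eV.
transitivity (\int[mu \x nu]_z (z.1 * z.2)%:E).
  rewrite (eq_measure_integral (pushforward P (fun w => (U w, V w))));
    last first.
    by move=> A mA _; exact: joint_law.
  by rewrite integral_pushforward.
rewrite -integral12_prod_meas1//.
rewrite (eq_integral (fun x : R => x%:E * \int[nu]_y y%:E)); last first.
  by move=> x _; rewrite /fubini_F -integralZl.
have fV : \int[nu]_y y%:E \is a fin_num by exact: integrable_fin_num iV'.
by rewrite -(fineK fV) integralZr.
Qed.

End Independence.

(** * Expectations as integrals against a density *)

Section Density.
Context (R : realType) (d : measure_display) (T : measurableType d).
Context (P : probability T R).
Local Open Scope ereal_scope.
Local Notation mu := (@lebesgue_measure R).

Import HBNNSimple.

Lemma integral_density_nnsfun (X : {RV P >-> R}) (f : R -> R)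
    (h : {nnsfun R >-> R}) : has_density X f ->
  \int[distribution P X]_x (h x)%:E = \int[mu]_x (h x * f x)%:E.
Proof.
move=> [mf f0 Xf].
under [LHS]eq_integral do rewrite fimfunE -fsumEFin//.
rewrite [LHS]ge0_integral_fsum//; last 2 first.
- by move=> r; exact/measurable_EFinP/measurableT_comp.
- by move=> n x _; rewrite EFinM nnfun_muleindic_ge0.
have hE x : (h x * f x)%:E =
    \sum_(r \in range h) (r * \1_(h @^-1` [set r]) x * f x)%:E.
  by rewrite fimfunE mulr_fsuml fsumEFin.
have mh r : measurable_fun [set: R] (fun x =>
  r * \1_(h @^-1` [set r]) x * f x)%R.
  by apply: measurable_funM => //; apply: measurable_funM => //.
under [RHS]eq_integral do rewrite hE.
rewrite [RHS]ge0_integral_fsum//; last 2 first.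
- by move=> r; apply/measurable_EFinP; exact: mh.
- by move=> r x _; rewrite lee_fin mulr_ge0// -lee_fin EFinM
  nnfun_muleindic_ge0.
apply: eq_fsbigr => r /[!inE] -[x _ hx].
have r0 : (0 <= r)%R by rewrite -hx.
rewrite integralZl_indic_nnsfun// integral_indic// setIT [X in _ * X = _]Xf//.
rewrite -[X in X = _]/(_ * \int[mu]_(x in h @^-1` [set r]) (f x)%:E).
rewrite -ge0_integralZl//; last 3 first.
- by rewrite -[X in measurable X]setTI; exact: (measurable_funP h).
- by apply: measurable_funTS; exact/measurable_EFinP.
- by move=> y _; rewrite lee_fin.
rewrite [LHS]integral_mkcond; apply: eq_integral => y _; rewrite patchE indicE.
by case: ifPn => hy; rewrite ?mulr1 ?mulr0 ?mul0r// EFinM.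
Qed.

(** The density is specified on measurable sets; simple functions and monotone convergence carry the
    identity to nonnegative functions. *)
Lemma ge0_integral_density (X : {RV P >-> R}) (f g : R -> R) :
  has_density X f -> measurable_fun setT g -> (forall x, 0 <= g x)%R ->
  \int[P]_w (g (X w))%:E = \int[mu]_x (g x * f x)%:E.
Proof.
move=> Xf mg g0; have [mf f0 _] := Xf.
have mg' : measurable_fun setT (EFin \o g) by exact/measurable_EFinP.
have g0' x : setT x -> 0 <= (EFin \o g) x by rewrite lee_fin.
transitivity (\int[distribution P X]_x (g x)%:E).
  by rewrite ge0_integral_distribution// => x; rewrite lee_fin.
pose g_ := nnsfun_approx measurableT mg'.
transitivity (limn (fun n => \int[distribution P X]_x (g_ n x)%:E)).
  rewrite -monotone_convergence//=.
  - apply: eq_integral => ? /[!inE] xD; apply/esym/cvg_lim => //=.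
    exact: cvg_nnsfun_approx.
  - by move=> n; exact/measurable_EFinP/measurable_funTS.
  - by move=> n ? _; rewrite lee_fin.
  - by move=> ? _ ? ? mn; rewrite lee_fin; exact/lefP/nd_nnsfun_approx.
have mgf n : measurable_fun [set: R] (fun x => g_ n x * f x)%R.
  by apply: measurable_funM => //.
under eq_fun do rewrite (integral_density_nnsfun _ Xf).
rewrite -monotone_convergence//=.
- apply: eq_integral => x _; apply/cvg_lim => //=.
  under eq_fun do rewrite EFinM; rewrite EFinM.
  apply: cvgeM; [|exact: cvg_nnsfun_approx|exact: cvg_cst].
  by rewrite mule_def_fin.
- by move=> n; apply/measurable_EFinP; exact: mgf.
- by move=> n x _; rewrite lee_fin mulr_ge0.
- move=> x _ i j ij; rewrite lee_fin ler_wpM2r//.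
  by have /lefP/(_ x) := nd_nnsfun_approx measurableT mg' ij.
Qed.

End Density.

(** * Square integrability, and a Cauchy-Schwarz bound on an event *)

Section Moments.
Context (R : realType) (d : measure_display) (T : measurableType d).
Variable mu : {measure set T -> \bar R}.

Lemma integrable_eqfun (D : set T) (f g : T -> \bar R) : f =1 g ->
  mu.-integrable D f -> mu.-integrable D g.
Proof. by move=> /funext ->. Qed.

Lemma integrable_mul_L2 (D : set T) (f g : T -> R) : measurable D ->
  measurable_fun D f -> measurable_fun D g ->
  mu.-integrable D (fun x => (f x ^+ 2)%:E) ->
  mu.-integrable D (fun x => (g x ^+ 2)%:E) ->
  mu.-integrable D (fun x => (f x * g x)%:E).
Proof.
move=> mD mf mg f2 g2.
apply: (le_integrable mD _ _ (integrableD mD f2 g2)).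
  by apply/measurable_EFinP; exact: measurable_funM.
move=> x _; rewrite -EFinD !abse_EFin lee_fin normrM.
rewrite [leRHS]ger0_norm ?addr_ge0 ?sqr_ge0// -(real_normK (num_real (f x))).
rewrite -(real_normK (num_real (g x))).
by have := normr_ge0 (f x); have := normr_ge0 (g x); nra.
Qed.

Lemma integrable_sqrD (D : set T) (f g : T -> R) : measurable D ->
  measurable_fun D f -> measurable_fun D g ->
  mu.-integrable D (fun x => (f x ^+ 2)%:E) ->
  mu.-integrable D (fun x => (g x ^+ 2)%:E) ->
  mu.-integrable D (fun x => ((f x + g x) ^+ 2)%:E).
Proof.
move=> mD mf mg f2 g2.
have h := integrableD mD f2 g2.
apply: (le_integrable mD _ _ (integrableD mD h h)).
  by apply/measurable_EFinP; apply: measurable_funX; exact: measurable_funD.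
move=> x _; rewrite -!EFinD !abse_EFin lee_fin ger0_norm ?sqr_ge0//.
rewrite ger0_norm ?addr_ge0 ?sqr_ge0//.
by have := sqr_ge0 (f x - g x); nra.
Qed.

Lemma Rintegral_sum (D : set T) (I : Type) (s : seq I) (f : I -> T -> R) :
  measurable D -> (forall i, mu.-integrable D (EFin \o f i)) ->
  mu.-integrable D (EFin \o (fun x => \sum_(i <- s) f i x)) /\
  \int[mu]_(x in D) (\sum_(i <- s) f i x) = \sum_(i <- s) \int[mu]_(x in D) f i
    x.
Proof.
move=> mD fi; elim: s => [|i s [IH1 IH2]].
  rewrite big_nil; split.
    by apply: integrable_eqfun (integrable0 _ _) => x; rewrite /= big_nil.
  under eq_Rintegral do rewrite big_nil.
  by rewrite Rintegral_cst ?mul0r.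
split.
  apply: integrable_eqfun (integrableD mD (fi i) IH1) => x.
  by rewrite /= big_cons EFinD.
rewrite big_cons -IH2 -RintegralD//.
by apply: eq_Rintegral => x _; rewrite big_cons.
Qed.

End Moments.

(** The assumed bound is smallest at s = sqrt q / sqrt a, where it equals sqrt a sqrt q. If a = 0
    and v > 0, the choice s = q / v would give v <= v / 2. *)
Lemma le_sqrt_mul (R : realType) (a q v : R) : 0 <= a -> 0 < q ->
  (forall s, 0 < s -> v <= (s * a + q / s) / 2) ->
  v <= Num.sqrt a * Num.sqrt q.
Proof.
move=> a0 q0 H; have [a00|an0] := eqVneq a 0.
  rewrite a00 sqrtr0 mul0r leNgt; apply/negP => v0.
  have := H (q / v) (divr_gt0 q0 v0); rewrite a00 mulr0 add0r.
  have -> : q / (q / v) = v by field; rewrite !gt_eqF.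
  lra.
have ap : 0 < a by rewrite lt_neqAle eq_sym an0.
have sa : 0 < Num.sqrt a by rewrite sqrtr_gt0.
have sq : 0 < Num.sqrt q by rewrite sqrtr_gt0.
have := H _ (divr_gt0 sq sa).
have -> : Num.sqrt q / Num.sqrt a * a = Num.sqrt a * Num.sqrt q.
  rewrite -{2}(sqr_sqrtr a0); field; exact: lt0r_neq0.
have -> : q / (Num.sqrt q / Num.sqrt a) = Num.sqrt a * Num.sqrt q.
  rewrite -{1}(sqr_sqrtr (ltW q0)); field; rewrite !lt0r_neq0//.
lra.
Qed.

(** Integrates Z^2 1_A <= (s Z^4 + 1_A / s) / 2, valid for every s > 0, then optimizes over s. The
    bound [q] replaces the probability of [A], so that it is positive even for a null event. *)
Lemma event_cauchy_schwarz (R : realType) (d : measure_display)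
    (T : measurableType d) (P : probability T R) (Z : T -> R) (A : set T)
    (q : R) : measurable_fun setT Z -> measurable A -> 0 < q ->
  (P A <= q%:E)%E -> (\int[P]_w (Z w ^+ 4)%:E < +oo)%E ->
  P.-integrable setT (fun w => (Z w ^+ 2 * \1_A w)%:E) /\
  \int[P]_w (Z w ^+ 2 * \1_A w) <=
    Num.sqrt (fine (\int[P]_w (Z w ^+ 4)%:E)) * Num.sqrt q.
Proof.
move=> mZ mA q0 PA Z4.
have iZ4 : P.-integrable setT (fun w => (Z w ^+ 4)%:E).
  apply/integrableP; split; first by apply/measurable_EFinP;
    exact: measurable_funX.
  by under eq_integral do rewrite abse_EFin ger0_norm ?exprn_even_ge0//.
have mA1 : measurable_fun setT (\1_A : T -> R) by exact: measurable_indic.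
have iA : P.-integrable setT (EFin \o (\1_A : T -> R))
  by exact: integrable_indic.
have iZ2 : P.-integrable setT (fun w => (Z w ^+ 2 * \1_A w)%:E).
  apply: integrable_mul_L2 => //; first exact: measurable_funX.
    by apply: integrable_eqfun iZ4 => x; rewrite -exprM.
  by apply: integrable_eqfun iA => x /=; rewrite indicE; case: (_ \in _);
    rewrite ?expr1n ?expr0n.
split=> //.
apply: le_sqrt_mul => //.
  by apply/fine_ge0/integral_ge0 => w _; rewrite lee_fin exprn_even_ge0.
move=> s s0.
have i1 := integrableZl measurableT (s / 2) iZ4.
have i2 := integrableZl measurableT (s^-1 / 2) iA.
apply: (@le_trans _ _ (\int[P]_w (s / 2 * Z w ^+ 4 + s^-1 / 2 * \1_A w))).
  apply: le_Rintegral => //.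
    by apply: integrable_eqfun (integrableD measurableT i1 i2).
  move=> w _; have e2 : (\1_A w : R) ^+ 2 = \1_A w.
    by rewrite indicE; case: (_ \in _); rewrite ?expr1n ?expr0n.
  have := sqr_ge0 (s * Z w ^+ 2 - \1_A w); rewrite sqrrB exprMn e2 -exprM.
  move: (\1_A w : R) (Z w) => x y H.
  rewrite -(ler_pM2l s0) -subr_ge0.
  suff -> : s * (s / 2 * y ^+ 4 + s^-1 / 2 * x) - s * (y ^+ 2 * x) =
    (s ^+ 2 * y ^+ (2 * 2) - s * y ^+ 2 * x *+ 2 + x) / 2 by rewrite divr_ge0.
  by field; rewrite gt_eqF.
rewrite RintegralD// RintegralZl// RintegralZl//.
have -> : \int[P]_w (\1_A w : R) = fine (P A).
  by rewrite /Rintegral integral_indic// setIT.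
have pq : fine (P A) <= q by rewrite -lee_fin fineK// fin_num_measure.
rewrite -/(Rintegral P setT (fun w => Z w ^+ 4)) mulrDl.
rewrite (mulrAC s) lerD2l mulrC mulrA ler_pM2r// ler_pM2r ?invr_gt0//.
Qed.

(** * Functions of one family, and centered noise independent of it *)

Section SigmaAlgebraOf.
Context (R : realType) (d : measure_display) (T : measurableType d).
Context (P : probability T R).

Section one_family.
Context (n : nat) (X : 'I_n -> {RV P >-> R}).

(** [T] under the sigma-algebra generated by the family. As a measurable type of its own, it
    inherits all closure properties of measurable functions. *)
Definition sigma_type : Type := g_sigma_algebraType
  (\bigcup_i preimage_set_system [set: T] (X i) (@measurable _ R)).

HB.instance Definition _ := Measurable.on sigma_type.

Definition sigma_measurable (g : T -> R) : Prop :=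
  measurable_fun [set: sigma_type] (g : sigma_type -> R).

Lemma sigma_algebra_of_measurable (A : set T) :
  sigma_algebra_of X A -> measurable A.
Proof.
apply: smallest_sub; first exact: sigma_algebra_measurable.
move=> _ [i _ [B mB <-]].
exact: measurable_funP.
Qed.

Lemma sigma_measurable_fun (g : T -> R) :
  sigma_measurable g -> measurable_fun setT g.
Proof.
by move=> mg _ B mB; apply: sigma_algebra_of_measurable; exact: mg.
Qed.

Lemma sigma_measurable_self i : sigma_measurable (X i).
Proof.
move=> _ B mB; apply: sub_sigma_algebra; exists i => //; exists B => //.
Qed.

Lemma sigma_measurable_comp (g : R -> R) i :
  measurable_fun setT g -> sigma_measurable (g \o X i).
Proof. by move=> mg; apply: measurableT_comp => //;
  exact: sigma_measurable_self. Qed.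

Lemma sigma_measurableM (g h : T -> R) : sigma_measurable g ->
  sigma_measurable h -> sigma_measurable (fun w => g w * h w).
Proof. by move=> mg mh; exact: (@measurable_funM _ sigma_type). Qed.

End one_family.

Lemma sigma_independent_rv (n k : nat) (X : 'I_n -> {RV P >-> R})
    (Z : 'I_k -> {RV P >-> R}) (U V : T -> R) : independent_families X Z ->
  sigma_measurable X U -> sigma_measurable Z V -> independent_rv P U V.
Proof.
move=> XZ mU mV A B mA mB; apply: XZ.
  by rewrite -[U @^-1` A]setTI; exact: mU.
by rewrite -[V @^-1` B]setTI; exact: mV.
Qed.

Lemma independent_rv_integral (U V : T -> R) : measurable_fun setT U ->
  measurable_fun setT V -> independent_rv P U V ->
  P.-integrable setT (EFin \o U) -> P.-integrable setT (EFin \o V) ->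
  P.-integrable setT (EFin \o (fun w => U w * V w)) /\
  \int[P]_w (U w * V w) = \int[P]_w U w * \int[P]_w V w.
Proof.
move=> mU mV UV iU iV.
pose U' : {mfun T >-> R} := HB.pack U (isMeasurableFun.Build _ _ _ _ _ mU).
pose V' : {mfun T >-> R} := HB.pack V (isMeasurableFun.Build _ _ _ _ _ mV).
exact: (@integrable_mul_indep _ _ _ P U' V').
Qed.

Lemma mutually_independent_pair (n : nat) (Z : 'I_n -> {RV P >-> R}) i j :
  mutually_independent Z -> i != j -> independent_rv P (Z i) (Z j).
Proof.
move=> mZ ij A B mA mB.
have := mZ [set i; j]%SET (fun k => if k == i then A else B).
have -> : (\bigcap_(k in [set` [set i; j]%SET])
    (Z k @^-1` (if k == i then A else B))) = Z i @^-1` A `&` Z j @^-1` B.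
  apply/seteqP; split=> w /=.
    move=> H; split; first by have := H i; rewrite /= !inE eqxx; exact.
    by have := H j; rewrite /= !inE eqxx orbT eq_sym (negbTE ij); exact.
  move=> [Aw Bw] k /=; rewrite !inE => /orP[|] /eqP ->; first by rewrite eqxx.
  by rewrite eq_sym (negbTE ij).
rewrite big_setU1 ?inE//= big_set1 eqxx eq_sym (negbTE ij); apply.
by move=> k; case: ifP.
Qed.

Section noise.
Context (n : nat) (X eps : 'I_n -> {RV P >-> R}) (sigma : R).
Hypothesis heps : mutually_independent eps.
Hypothesis heps_mean : forall i, ('E_P[eps i] = 0)%E.
Hypothesis heps_var : forall i, ('V_P[eps i] = (sigma ^+ 2)%:E)%E.
Hypothesis hXeps : independent_families X eps.

Lemma noise_sq_integral i : (\int[P]_w (eps i w ^+ 2)%:E = (sigma ^+ 2)%:E)%E.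
Proof.
rewrite -(heps_var i) /variance covariance.unlock heps_mean expectation.unlock.
apply: eq_integral => w _ /=; congr (_%:E).
by rewrite -[RHS]/((eps i w - 0) * (eps i w - 0)) subr0 expr2.
Qed.

Lemma noise_sq_integrable i : P.-integrable setT (fun w => (eps i w ^+ 2)%:E).
Proof.
apply/integrableP; split.
  by apply/measurable_EFinP; exact: measurable_funX.
under eq_integral do rewrite abse_EFin ger0_norm ?sqr_ge0//.
by rewrite noise_sq_integral ltry.
Qed.

Lemma noise_integrable i : P.-integrable setT (EFin \o eps i).
Proof.
have i1 : P.-integrable setT (fun w => ((cst 1 : T -> R) w ^+ 2)%:E).
  apply: integrable_eqfun (finite_measure_integrable_cst P 1 measurableT) => w.
  by rewrite /= expr1n.
apply: integrable_eqfun (integrable_mul_L2 measurableT _ _ (noise_sq_integrable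
  i) i1) => //.
by move=> w; rewrite /= mulr1.
Qed.

Lemma noise_mean i : \int[P]_w eps i w = 0.
Proof.
by rewrite /Rintegral -[(\int[P]_w _)%E]expectation_def heps_mean.
Qed.

Lemma noise_cov i j : P.-integrable setT (fun w => (eps i w * eps j w)%:E) /\
  \int[P]_w (eps i w * eps j w) = (i == j)%:R * sigma ^+ 2.
Proof.
split; first by apply: integrable_mul_L2 => //; exact: noise_sq_integrable.
have [<-|ij] := eqVneq i j.
  rewrite mul1r /Rintegral; under eq_integral do rewrite -expr2.
  by rewrite noise_sq_integral.
have [||_ ->] := independent_rv_integral _ _ (mutually_independent_pair heps ij)
  (noise_integrable i) (noise_integrable j) => //.
by rewrite !noise_mean mulr0 mul0r.
Qed.

(** Takes the place of conditioning on the design. The products [a k * a l] and [a k * beta] are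
    independent of the noise, so expectations factor: terms linear in the noise vanish, and only the
    diagonal of the double sum survives. *)
Lemma noise_quadratic (a : 'I_n -> T -> R) (beta : T -> R) :
  (forall k, sigma_measurable X (a k)) -> sigma_measurable X beta ->
  (forall k, P.-integrable setT (fun w => (a k w ^+ 2)%:E)) ->
  P.-integrable setT (fun w => (beta w ^+ 2)%:E) ->
  P.-integrable setT
    (fun w => ((\sum_k a k w * eps k w + beta w) ^+ 2)%:E) /\
  \int[P]_w (\sum_k a k w * eps k w + beta w) ^+ 2 =
    sigma ^+ 2 * \sum_k \int[P]_w a k w ^+ 2 + \int[P]_w beta w ^+ 2.
Proof.
move=> sa sb ia ib.
have ma k := sigma_measurable_fun (sa k); have mb := sigma_measurable_fun sb.
have iaa k l : P.-integrable setT (EFin \o (fun w => a k w * a l w)).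
  exact: integrable_mul_L2.
have iab k : P.-integrable setT (EFin \o (fun w => a k w * beta w)).
  exact: integrable_mul_L2.
have se k : sigma_measurable eps (eps k) by exact: sigma_measurable_self.
have hkl k l :
    P.-integrable setT (EFin \o (fun w =>
      a k w * a l w * (eps k w * eps l w))) /\
    \int[P]_w (a k w * a l w * (eps k w * eps l w)) =
    (k == l)%:R * sigma ^+ 2 * \int[P]_w (a k w * a l w).
  have [iee eee] := noise_cov k l.
  have sa2 : sigma_measurable X (fun w => a k w * a l w)
    by exact: sigma_measurableM.
  have se2 : sigma_measurable eps (fun w => eps k w * eps l w)
    by exact: sigma_measurableM.
  have [||i1 e1] := independent_rv_integral _ _ (sigma_independent_rv hXeps sa2
    se2) (iaa k l) iee.
  - exact: measurable_funM.
  - exact: measurable_funM.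
  by split=> //; rewrite e1 eee mulrC.
have hk k :
    P.-integrable setT (EFin \o (fun w => a k w * beta w * eps k w)) /\
    \int[P]_w (a k w * beta w * eps k w) = 0.
  have sab : sigma_measurable X (fun w => a k w * beta w)
    by exact: sigma_measurableM.
  have [||i1 e1] := independent_rv_integral _ _ (sigma_independent_rv hXeps sab
    (se k)) (iab k) (noise_integrable k).
  - exact: measurable_funM.
  - by [].
  by split=> //; rewrite e1 noise_mean mulr0.
have E w : (\sum_k a k w * eps k w + beta w) ^+ 2 =
    \sum_k (\sum_l a k w * a l w * (eps k w * eps l w)) +
    2 * \sum_k a k w * beta w * eps k w + beta w ^+ 2.
  rewrite sqrrD; congr (_ + _ + _).
    rewrite expr2 mulr_suml; apply: eq_bigr => k _; rewrite mulr_sumr.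
    by apply: eq_bigr => l _; rewrite mulrACA.
  rewrite -mulr_natl mulr_suml; congr (_ * _).
  by apply: eq_bigr => k _; rewrite mulrAC.
have h1 k := Rintegral_sum (index_enum 'I_n) measurableT (fun l => (hkl k l).1).
have h2 := Rintegral_sum (index_enum 'I_n) measurableT (fun k => (h1 k).1).
have h3 := Rintegral_sum (index_enum 'I_n) measurableT (fun k => (hk k).1).
have i3 := integrableZl measurableT 2 h3.1.
have i23 := integrableD measurableT h2.1 i3.
split.
  apply: integrable_eqfun (integrableD measurableT i23 ib) => w.
  by rewrite E.
under eq_Rintegral do rewrite E.
rewrite (RintegralD measurableT i23 ib) (RintegralD measurableT h2.1 i3).
rewrite (RintegralZl 2 measurableT h3.1).
rewrite h2.2 h3.2 [X in 2 * X]big1 ?mulr0 ?addr0; last by move=> k _;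
  exact: (hk k).2.
congr (_ + _); rewrite mulr_sumr; apply: eq_bigr => k _.
rewrite (h1 k).2 (bigD1 k)//= (hkl k k).2 eqxx mul1r big1 ?addr0 => [|l lk].
  by [].
by rewrite (hkl k l).2 eq_sym (negbTE lk) !mul0r.
Qed.

End noise.
End SigmaAlgebraOf.

(** * Measurability of random matrices *)

Section MatrixMeasurability.
Context (R : realType) (d : measure_display) (T : measurableType d).

Lemma measurable_invr : measurable_fun [set: R] (fun x : R => x^-1).
Proof.
rewrite (_ : [set: R] = [set 0] `|` ~` [set 0]); last by rewrite setUv.
apply/measurable_funU => //; first exact: measurableC.
split; first exact: measurable_fun_set1.
apply: open_continuous_measurable_fun.
  by apply: closed_openC; exact: closed_eq.
by move=> x; rewrite inE/= => /eqP x0; apply: cvgV => //; exact: cvg_id.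
Qed.

Definition measurable_mx k l (M : T -> 'M[R]_(k, l)) : Prop :=
  forall i j, measurable_fun [set: T] (fun w => M w i j).

Lemma measurable_mx_mul k l r (M : T -> 'M[R]_(k, l)) (N : T -> 'M[R]_(l, r)) :
  measurable_mx M -> measurable_mx N -> measurable_mx (fun w => M w *m N w).
Proof.
move=> mM mN i j; under eq_fun do rewrite mxE.
by apply: measurable_sum => s; exact: measurable_funM.
Qed.

Lemma measurable_mx_cst k l (M : 'M[R]_(k, l)) : measurable_mx (fun _ => M).
Proof. by move=> i j; exact: measurable_cst. Qed.

Lemma measurable_mx_row k (g : 'I_k -> T -> R) :
  (forall j, measurable_fun [set: T] (g j)) ->
  measurable_mx (fun w => \row_j g j w).
Proof. by move=> mg i j; under eq_fun do rewrite mxE; exact: mg. Qed.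

Lemma measurable_mx_scale k l a (M : T -> 'M[R]_(k, l)) :
  measurable_mx M -> measurable_mx (fun w => a *: M w).
Proof. by move=> mM i j; under eq_fun do rewrite mxE;
  exact: measurable_funM. Qed.

Lemma measurable_mx_sub k l (M N : T -> 'M[R]_(k, l)) :
  measurable_mx M -> measurable_mx N -> measurable_mx (fun w => M w - N w).
Proof.
move=> mM mN i j; under eq_fun do rewrite !mxE.
exact: measurable_funB.
Qed.

Lemma measurable_mx_tr k l (M : T -> 'M[R]_(k, l)) :
  measurable_mx M -> measurable_mx (fun w => (M w)^T).
Proof. by move=> mM i j; under eq_fun do rewrite mxE; exact: mM. Qed.

Lemma measurable_mx_det k (M : T -> 'M[R]_k) :
  measurable_mx M -> measurable_fun [set: T] (fun w => \det (M w)).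
Proof.
move=> mM; rewrite /determinant; apply: measurable_sum => s.
by apply: measurable_funM => //; apply: measurable_prod => i _; exact: mM.
Qed.

Lemma measurable_mx_adj k (M : T -> 'M[R]_k) :
  measurable_mx M -> measurable_mx (fun w => \adj (M w)).
Proof.
move=> mM i j; under eq_fun do rewrite mxE.
apply: measurable_funM => //; apply: measurable_mx_det => a b.
by under eq_fun do rewrite !mxE; exact: mM.
Qed.

Lemma measurable_mx_inv k (M : T -> 'M[R]_k) :
  measurable_mx M -> measurable_mx (fun w => invmx (M w)).
Proof.
move=> mM i j; pose D := (fun w => \det (M w)) @^-1` [set 0].
have mdet := measurable_mx_det mM.
have mD : measurable D by rewrite -[D]setTI; exact: mdet.
(* Cramer's rule off [D]; on [D], where the matrix is singular, [invmx] returns its argument. *)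
rewrite (_ : (fun w => _) = fun w =>
  (\det (M w))^-1 * \adj (M w) i j * \1_(~` D) w + M w i j * \1_D w).
  apply: measurable_funD; apply: measurable_funM.
  - apply: measurable_funM; last exact: measurable_mx_adj.
    exact: (measurableT_comp measurable_invr).
  - by apply: measurable_indic; exact: measurableC.
  - exact: mM.
  - exact: measurable_indic.
apply/funext => w; rewrite /invmx unitmxE unitfE !indicE in_setC.
have [dw|dw] := eqVneq (\det (M w)) 0.
  by rewrite (_ : (w \in D) = true) /= ?mulr0 ?mulr1 ?add0r//; apply/mem_set.
rewrite (_ : (w \in D) = false) /= ?mulr0 ?mulr1 ?addr0 ?mxE//.
by apply/negbTE; rewrite notin_setE /D/=; exact/eqP.
Qed.

(** Negativity at a real vector is an open condition, so it would also occur at a nearby rational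
    vector. *)
Lemma qform_rat k (A : 'M[R]_k) :
  (forall z : 'rV[rat]_k, 0 <= qform A (map_mx ratr z)) ->
  forall v, 0 <= qform A v.
Proof.
move=> H v; rewrite leNgt; apply/negP => Av.
have : nbhs v (qform A @^-1` [set x | x < 0]).
  apply: (@continuous_qform _ _ A v); apply: open_nbhs_nbhs.
  by split => //; exact: open_lt.
move=> /nbhs_ballP[e /= e0 He].
have /choice[z hz] : forall i : 'I_k, exists q : rat, ratr q \in `](v 0 i - e),
  (v 0 i + e)[.
  by move=> i; apply: rat_in_itvoo; lra.
suff : qform A (map_mx ratr (\row_i z i)) < 0 by rewrite ltNge H.
apply: He; split => // i j; rewrite !ord1 !mxE.
have := hz j; rewrite in_itv/= /ball/= ltr_distlC => /andP[h1 h2].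
by apply/andP; split; lra.
Qed.

(** Uncountably many constraints reduce to those at rational vectors, enumerated by [unpickle];
    integers that code no vector impose nothing. *)
Lemma measurable_qform_ge0 k (M : T -> 'M[R]_k) : measurable_mx M ->
  measurable [set w | forall v, 0 <= qform (M w) v].
Proof.
move=> mM.
pose S (N : nat) : set T := if unpickle N is Some z then
  [set w | 0 <= qform (M w) (map_mx (ratr : rat -> R) (z : 'rV[rat]_k))] else
    setT.
rewrite (_ : [set w | _] = \bigcap_N S N).
  apply: bigcapT_measurable => N; rewrite /S; case: unpickle => [z|//].
  rewrite (_ : [set w | _] = (fun w =>
    qform (M w) (map_mx ratr z)) @^-1` `[0, +oo[).
    have mq : measurable_fun setT (fun w => qform (M w) (map_mx ratr z)).
      under eq_fun do rewrite qform_sum.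
      apply: measurable_sum => i; apply: measurable_sum => j.
      by apply: measurable_funM => //; apply: measurable_funM => //; exact: mM.
    by rewrite -[X in measurable X]setTI; exact: mq.
  by apply/seteqP; split => w /=; rewrite in_itv/= andbT.
apply/seteqP; split => w /=.
  by move=> H N _; rewrite /S; case: unpickle => //= z; exact: H.
move=> H; apply: qform_rat => z.
by have := H (pickle z) I; rewrite /S pickleK.
Qed.

End MatrixMeasurability.

(** * Square-integrable functions on an interval *)

Section L2Interval.
Context (R : realType).
Local Notation mu := (@lebesgue_measure R).
Variables (I : set R).
Hypothesis hI : is_interval I.

Lemma measurable_I : measurable I.
Proof. exact: is_interval_measurable. Qed.
Let mI := measurable_I.

Lemma square_integrable_mul (g h : R -> R) :
  square_integrable I g -> square_integrable I h ->
  mu.-integrable I (EFin \o (fun x => g x * h x)).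
Proof. by move=> [mg ig] [mh ih]; exact: integrable_mul_L2. Qed.

Lemma square_integrableD (g h : R -> R) : square_integrable I g ->
  square_integrable I h -> square_integrable I (fun x => g x + h x).
Proof.
move=> [mg ig] [mh ih]; split; first exact: measurable_funD.
exact: integrable_sqrD.
Qed.

Lemma square_integrableZ (a : R) (g : R -> R) : square_integrable I g ->
  square_integrable I (fun x => a * g x).
Proof.
move=> [mg ig]; split; first exact: measurable_funM.
have := integrableZl (mu := mu) mI (a ^+ 2) ig; apply: eq_integrable => // x _.
by rewrite -EFinM exprMn.
Qed.

Lemma square_integrableB (g h : R -> R) : square_integrable I g ->
  square_integrable I h -> square_integrable I (g \- h).
Proof.
move=> sg sh; have := square_integrableD sg (square_integrableZ (-1) sh).
by congr square_integrable; apply/funext => x /=; rewrite mulN1r.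
Qed.

Lemma eq_square_integrable (g h : R -> R) : {in I, g =1 h} ->
  square_integrable I g -> square_integrable I h.
Proof.
move=> gh [mg ig]; split; first exact: eq_measurable_fun mg.
by apply: eq_integrable ig => // x xI; rewrite gh.
Qed.

Variable f : R -> R.
Hypothesis mf : measurable_fun [set: R] f.
Hypothesis f0 : forall x, 0 <= f x.
Hypothesis fM : exists M : R, forall x, I x -> f x <= M.

Lemma square_integrable_mulf (g h : R -> R) :
  square_integrable I g -> square_integrable I h ->
  mu.-integrable I (EFin \o (fun x => g x * h x * f x)).
Proof.
move=> sg sh; have [M hM] := fM.
have [mg _] := sg; have [mh _] := sh.
have mf' : measurable_fun I f by exact: measurable_funTS.
apply: (le_integrable (mu := mu) mI _ _ (integrableZl (mu := mu) mI M
  (square_integrable_mul sg sh))).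
  apply/measurable_EFinP; apply: measurable_funM => //; exact: measurable_funM.
move=> x Ix; rewrite -EFinM !abse_EFin lee_fin mulrC !normrM.
rewrite ler_wpM2r ?mulr_ge0//.
by rewrite ger0_norm// (le_trans (hM x Ix))// ler_norm.
Qed.

Lemma Rintegral_support (g : R -> R) : (forall x, ~ I x -> g x = 0) ->
  (\int[mu]_x (g x)%:E = \int[mu]_(x in I) (g x)%:E)%E.
Proof.
move=> gI; rewrite [RHS]integral_mkcond; apply: eq_integral => x _.
by rewrite patchE; case: ifPn => // xI; rewrite gI// => /mem_set;
  rewrite (negbTE xI).
Qed.

Lemma sup_f_ub x : I x -> f x <= sup [set f y | y in I].
Proof.
move=> Ix; apply: ub_le_sup; last by exists x.
by have [M hM] := fM; exists M => _ [y Iy <-]; exact: hM.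
Qed.

Lemma sqnormf_ge0 (g : R -> R) : 0 <= sqnormf I f g.
Proof.
by apply: Rintegral_ge0 => x _; rewrite mulr_ge0// -expr2 sqr_ge0.
Qed.

Lemma sqnormf_le_sup (g : R -> R) : square_integrable I g ->
  sqnormf I f g <= sup [set f y | y in I] * sqnormL2 I g.
Proof.
move=> sg; rewrite /sqnormf /sqnormL2 /dotf /dotL2 -RintegralZl//; last first.
  exact: square_integrable_mul.
apply: le_Rintegral => //.
- exact: square_integrable_mulf.
- have := integrableZl (mu := mu) mI (sup [set f y | y in I])
  (square_integrable_mul sg sg).
  by apply: eq_integrable => // x _.
- by move=> x Ix; rewrite mulrC ler_wpM2r ?sup_f_ub// -expr2 sqr_ge0.
Qed.

Section expectation.
Context (d : measure_display) (T : measurableType d) (P : probability T R).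
Variable X : {RV P >-> R}.
Hypothesis Xf : has_density X f.

Lemma density_sq_integral (g : R -> R) : measurable_fun [set: R] g ->
  (forall x, ~ I x -> g x = 0) -> square_integrable I g ->
  P.-integrable setT (fun w => (g (X w) ^+ 2)%:E) /\
  \int[P]_w g (X w) ^+ 2 = sqnormf I f g.
Proof.
move=> mg gI sg.
have mg2 : measurable_fun [set: R] (fun x => g x ^+ 2)
  by exact: measurable_funX.
have E : (\int[P]_w (g (X w) ^+ 2)%:E =
    \int[mu]_(x in I) (g x * g x * f x)%:E)%E.
  rewrite (ge0_integral_density Xf mg2); last by move=> x; exact: sqr_ge0.
  rewrite Rintegral_support => [|x Ix]; last by rewrite gI// expr0n mul0r.
  by apply: eq_integral => x _; rewrite expr2.
have := integrable_fin_num (mu := mu) mI (square_integrable_mulf sg sg).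
rewrite ge0_fin_numE; last first.
  by apply: integral_ge0 => x _; rewrite lee_fin mulr_ge0// -expr2 sqr_ge0.
rewrite -E => Eoo; split; last by rewrite /Rintegral E.
apply/integrableP; split.
  by apply/measurable_EFinP; apply: measurable_funX; exact: measurableT_comp.
by under eq_integral do rewrite abse_EFin ger0_norm ?sqr_ge0//.
Qed.

End expectation.
End L2Interval.

(** * Linearity of the derivative along an interval *)

Section DerivativeOnInterval.
Context (R : realType) (I : set R).
Hypothesis hI : is_interval I.
Hypothesis I2 : forall x, I x -> exists2 y, I y & y != x.

(** Properness makes limits unique, hence [lim] computable. Nonzero increments of any size below
    some bound exist, because the segment from [x] to another point of [I] stays in [I]. *)
Lemma proper_within_interval x : I x ->
  ProperFilter (within [set h | I (x + h)] 0^').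
Proof.
move=> Ix; have [y Iy yx] := I2 Ix.
apply: Build_ProperFilter_ex => A.
rewrite /within/= => /nbhs_ballP[e /= e0 He].
pose D := `|y - x|; have D0 : 0 < D by rewrite normr_gt0 subr_eq0.
(* [e / (2 * D)] keeps the increment within [e / 2], and the cap 1 keeps [x + h] between [x] and
   [y]. *)
pose t := Num.min 1 (e / (2 * D)).
have t0 : 0 < t by rewrite lt_min ltr01 divr_gt0// mulr_gt0.
have t1 : t <= 1 by rewrite ge_min lexx.
pose h := t * (y - x).
have h0 : h != 0 by rewrite mulf_neq0 ?subr_eq0// gt_eqF.
exists h; apply: (He h) => //=.
  rewrite /ball/= sub0r normrN normrM -/D gtr0_norm//.
  apply: (@le_lt_trans _ _ (e / (2 * D) * D)); first
    by rewrite ler_pM2r// ge_min lexx orbT.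
  rewrite (_ : e / (2 * D) * D = e / 2); last by field; rewrite gt_eqF.
  by lra.
rewrite /h; have [xy|xy] := leP x y.
  by apply: (hI Ix Iy); apply/andP; split; nra.
by apply: (hI Iy Ix); apply/andP; split; nra.
Qed.

Lemma deriv_on_lincomb (phi : nat -> R -> R) m (c : 'I_m -> R) x :
  (forall j, derivable_on I (phi j)) ->
  deriv_on I (lincomb phi c) x = \sum_(j < m) c j * deriv_on I (phi j) x.
Proof.
move=> dphi; have [xI|xI] := boolP (x \in I); last first.
  rewrite /deriv_on indicE (negbTE xI) mulr0 big1// => j _.
  by rewrite !mulr0.
have Ix : I x by exact: set_mem.
have FF := proper_within_interval Ix.
rewrite /deriv_on indicE xI mulr1; under eq_bigr do rewrite mulr1.
apply: cvg_lim => //.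
rewrite (_ : diff_quotient _ x = fun h =>
  \sum_(j < m) c j * diff_quotient (phi j) x h).
  apply: cvg_sumr => j; apply: cvgM; first exact: cvg_cst.
  exact: dphi.
apply/funext => h; rewrite /diff_quotient /lincomb -sumrB mulr_sumr.
by apply: eq_bigr => j _; rewrite -mulrBr mulrCA.
Qed.

End DerivativeOnInterval.

(** * Consequences of orthonormality, and the population Gram matrix *)

Section Basis.
Context (R : realType).
Local Notation mu := (@lebesgue_measure R).
Variables (I : set R) (phi : nat -> R -> R).
Hypothesis hI : is_interval I.
Hypothesis sphi : forall j, square_integrable I (phi j).
Hypothesis ophi : forall j k, dotL2 I (phi j) (phi k) = (j == k)%:R.

Let mI := measurable_I hI.

(** A one-point interval is Lebesgue-null, so no function on it has norm 1. *)
Lemma basis_nondegenerate x : I x -> exists2 y, I y & y != x.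
Proof.
move=> Ix; apply: contrapT => H.
have II : I = [set x].
  apply/seteqP; split => [y Iy|_ ->//].
  by apply: contrapT => /eqP yx; apply: H; exists y.
have := ophi 0 0; rewrite /dotL2 II Rintegral_set1 eqxx => /esym/eqP.
by rewrite oner_eq0.
Qed.

Lemma basis_point j : exists2 x, I x & phi j x != 0.
Proof.
apply: contrapT => H.
have := ophi j j; rewrite /dotL2 eqxx (@eq_Rintegral _ _ _ _ _ (cst 0)).
  by rewrite Rintegral_cst// mul0r => /esym/eqP; rewrite oner_eq0.
move=> x /set_mem Ix; rewrite /=.
by have [->|p0] := eqVneq (phi j x) 0; [rewrite mul0r|case: H; exists x].
Qed.

Lemma square_integrable_lincomb m (c : 'I_m -> R) :
  square_integrable I (lincomb phi c).
Proof.
rewrite /lincomb (_ : (fun x => _) = \sum_(j < m) (fun x => c j * phi j x)).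
  elim/big_ind : _ => [|g h sg sh|j _]; last exact: square_integrableZ.
    by have := square_integrableZ hI 0 (sphi 0); congr square_integrable;
      apply/funext => x; rewrite mul0r.
  exact: square_integrableD.
by apply/funext => x; rewrite fct_sumE.
Qed.

Lemma dotL2_lincombl m (c : 'I_m -> R) (j : 'I_m) :
  dotL2 I (lincomb phi c) (phi j) = c j.
Proof.
have h k : mu.-integrable I (EFin \o (fun x => c k * (phi k x * phi j x))).
  have := integrableZl (mu := mu) mI (c k) (square_integrable_mul hI (sphi k)
    (sphi j)).
  by apply: eq_integrable.
rewrite /dotL2.
transitivity (\int[mu]_(x in I) (\sum_(k < m) c k * (phi k x * phi j x))).
  apply: eq_Rintegral => x _; rewrite /lincomb mulr_suml.
  by apply: eq_bigr => k _; rewrite mulrA.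
rewrite (Rintegral_sum (mu := mu) (index_enum 'I_m) mI h).2 (bigD1 j)//= big1
  ?addr0 => [|k kj].
  rewrite RintegralZl//; last exact: square_integrable_mul.
  by have := ophi j j; rewrite /dotL2 => ->; rewrite eqxx mulr1.
rewrite RintegralZl//; last exact: square_integrable_mul.
have := ophi k j; rewrite /dotL2 => ->.
by rewrite (_ : (k == j :> nat) = false) ?mulr0//; exact/negbTE.
Qed.

Lemma lincomb_eq0 m (c : 'I_m -> R) : lincomb phi c = cst 0 -> forall j, c j =
  0.
Proof.
move=> c0 j; rewrite -(dotL2_lincombl c) c0 /dotL2.
rewrite (@eq_Rintegral _ _ _ _ _ (cst 0)) ?Rintegral_cst ?mul0r//.
by move=> x _; rewrite /= mul0r.
Qed.

Variable f : R -> R.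
Hypothesis mf : measurable_fun [set: R] f.
Hypothesis f0 : forall x, 0 <= f x.
Hypothesis fM : exists M : R, forall x, I x -> f x <= M.

Lemma sqnormf_lincomb m (v : 'rV[R]_m) :
  sqnormf I f (lincomb phi (v 0)) = qform (Psi I phi f m) v.
Proof.
have h k l : mu.-integrable I (EFin \o (fun x =>
  v 0 k * v 0 l * (phi k x * phi l x * f x))).
  have := integrableZl (mu := mu) mI (v 0 k * v 0 l) (square_integrable_mulf hI
    mf f0 fM (sphi k) (sphi l)).
  by apply: eq_integrable.
have h1 k := Rintegral_sum (mu := mu) (index_enum 'I_m) mI (h k).
rewrite /sqnormf /dotf.
transitivity (\int[mu]_(x in I) (\sum_(k < m) \sum_(l < m) v 0 k * v 0 l * (phi
  k x * phi l x * f x))).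
  apply: eq_Rintegral => x _; rewrite /lincomb !mulr_suml; apply: eq_bigr =>
    k _.
  rewrite mulr_sumr mulr_suml; apply: eq_bigr => l _; ring.
rewrite (Rintegral_sum (mu := mu) (index_enum 'I_m) mI (fun k =>
  (h1 k).1)).2 qform_sum.
apply: eq_bigr => k _; rewrite (h1 k).2; apply: eq_bigr => l _.
rewrite RintegralZl//; last exact: square_integrable_mulf.
by rewrite mxE /dotf; ring.
Qed.

Lemma psd_Psi m : psd (Psi I phi f m).
Proof.
split; last by move=> v; rewrite -/(qform _ v) -sqnormf_lincomb;
  exact: sqnormf_ge0.
apply/matrixP => i j; rewrite !mxE /dotf.
by apply: eq_Rintegral => x _; rewrite (mulrC (phi _ x)).
Qed.

(** An isotropic vector of a semidefinite form lies in its kernel, which is trivial for an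
    invertible matrix. *)
Lemma Psi_qform_gt0 m v : Psi I phi f m \in unitmx -> v != 0 ->
  0 < qform (Psi I phi f m) v.
Proof.
move=> uP v0; rewrite lt_neqAle (psd_Psi m).2 andbT eq_sym.
apply/eqP => /(psd_isotropic (psd_Psi m)) vP.
by move/eqP : v0; apply; rewrite -[v](mulmxK uP) vP mul0mx.
Qed.

Lemma ulsubmx_Psi m p : ulsubmx (Psi I phi f (m + p)) = Psi I phi f m.
Proof. by apply/matrixP => i j; rewrite !mxE. Qed.

End Basis.

(** * Matrix form of the estimator and of the events *)

Lemma dotmx_cauchy_schwarz (R : realType) n (u v : 'rV[R]_n) :
  dotmx u v ^+ 2 <= dotmx u u * dotmx v v.
Proof.
have [->|v0] := eqVneq v 0.
  by rewrite (_ : dotmx u 0 = 0) ?expr0n ?mulr_ge0 ?dotmxvv_ge0// /dotmx trmx0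
    mulmx0 mxE.
have vv : 0 < dotmx v v by rewrite lt_neqAle dotmxvv_ge0 eq_sym dotmxvv_eq0 v0.
have := dotmxvv_ge0 (dotmx v v *: u - dotmx u v *: v).
rewrite !(dotmxBl, dotmxBr, dotmxZl, dotmxZr) (dotmxC v u) => H.
rewrite -(ler_pM2l vv); nra.
Qed.

Section Links.
Context (R : realType) (I : set R) (phi : nat -> R -> R).

Lemma lsubmx_Phihat n m p (x : 'I_n -> R) :
  lsubmx (Phihat phi (m + p) x) = Phihat phi m x.
Proof. by apply/matrixP => i j; rewrite !mxE. Qed.

Lemma Psihat_gram_l n m p (x : 'I_n -> R) :
  Psihat phi m x = gram_l (Phihat phi (m + p) x).
Proof. by rewrite /gram_l lsubmx_Phihat. Qed.

Lemma lincomb_Phihat n q (x : 'I_n -> R) (v : 'rV[R]_q) i :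
  lincomb phi (v 0) (x i) = (v *m (Phihat phi q x)^T) 0 i.
Proof. by rewrite mxE; apply: eq_bigr => j _; rewrite !mxE. Qed.

Lemma sqnorm_emp_lincomb n q (x : 'I_n -> R) (v : 'rV[R]_q) :
  sqnorm_emp x (lincomb phi (v 0)) = qform (Psihat phi q x) v.
Proof.
rewrite /Psihat qformZm qform_gram_tr dotmxE; congr (_ * _).
by apply: eq_bigr => i _; rewrite lincomb_Phihat expr2.
Qed.

Lemma psd_Psihat n q (x : 'I_n -> R) : psd (Psihat phi q x).
Proof.
split; first by rewrite /Psihat linearZ/= trmx_mul trmxK.
move=> v; rewrite -/(qform _ v) -sqnorm_emp_lincomb mulr_ge0 ?invr_ge0//.
by apply: sumr_ge0 => i _; exact: sqr_ge0.
Qed.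

Lemma theta_hat_row n m p (x y : 'I_n -> R) j :
  theta_hat phi m x y j 0 =
  ((\row_i y i) *m lscoef (Phihat phi (m + p) x)) 0 j.
Proof.
have -> : theta_hat phi m x y j 0 = (theta_hat phi m x y)^T 0 j
  by rewrite [RHS]mxE.
congr (fun_of_matrix _ 0 j); rewrite /lscoef lsubmx_Phihat -Psihat_gram_l.
rewrite /theta_hat [LHS]linearZ/= !trmx_mul trmxK trmx_inv (psd_Psihat m x).1.
rewrite -scalemxAr; congr (_ *: (_ *m _)).
by apply/matrixP => a b; rewrite !mxE.
Qed.

Lemma db_hat_smoother n m p (x y : 'I_n -> R) (Delta : 'M[R]_(m, m + p)) i :
  (forall (j : 'I_m) (u : R),
     deriv_on I (phi j) u = \sum_(k < m + p) Delta j k * phi k u) ->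
  db_hat I phi m x y (x i) =
  ((\row_i y i) *m deriv_smoother (Phihat phi (m + p) x) Delta) 0 i.
Proof.
move=> hD; rewrite /deriv_smoother !mulmxA -lincomb_Phihat /db_hat /lincomb.
under eq_bigr do rewrite hD (theta_hat_row p).
under [RHS]eq_bigr do rewrite mxE mulr_suml.
rewrite exchange_big; apply: eq_bigr => k _ /=; rewrite mulr_sumr.
by apply: eq_bigr => j _; rewrite mulrA.
Qed.

Lemma calL_fin_ge0 (m : nat) x : I x -> (0 <= calL I phi m)%E.
Proof.
move=> Ix; apply: (@le_trans _ _ (\sum_(j < m) phi j x ^+ 2)%:E); last first.
  by apply: ereal_sup_ubound; exists x.
by rewrite lee_fin sumr_ge0// => j _; exact: sqr_ge0.
Qed.

(** Cauchy-Schwarz at each design point: the squared linear combination is at most |v|^2 times the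
    sum of the squared basis functions, which [L] bounds on [I] and which is 0 outside. *)
Lemma qform_Psihat_le n q (x : 'I_n -> R) (L : R) v : 0 <= L -> (0 < n)%N ->
  (forall j u, ~ I u -> phi j u = 0) -> calL I phi q = L%:E ->
  qform (Psihat phi q x) v <= L * dotmx v v.
Proof.
move=> L0 n0 hphi0 hL.
have leL u : \sum_(j < q) phi j u ^+ 2 <= L.
  have [Iu|Iu] := pselect (I u).
    by rewrite -lee_fin -hL; apply: ereal_sup_ubound; exists u.
  by rewrite big1// => j _; rewrite hphi0// expr0n.
rewrite -sqnorm_emp_lincomb /sqnorm_emp.
have nn : 0 < (n%:R : R) by rewrite ltr0n.
rewrite -(ler_pM2l nn) mulrA divff ?gt_eqF// mul1r.
apply: (@le_trans _ _ (\sum_(i < n) L * dotmx v v)); last first.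
  by rewrite sumr_const card_ord -[leLHS]mulr_natl.
apply: ler_sum => i _; pose r : 'rV[R]_q := \row_j phi j (x i).
have -> : lincomb phi (v 0) (x i) = dotmx v r.
  by rewrite dotmxE; apply: eq_bigr => j _; rewrite mxE.
apply: le_trans (dotmx_cauchy_schwarz _ _) _;
  rewrite mulrC ler_wpM2r ?dotmxvv_ge0//.
by rewrite dotmxE (le_trans _ (leL (x i)))//; apply: ler_sum => j _;
  rewrite mxE expr2.
Qed.

(** The maximum with 1 amounts to two bounds, one of them [L <= C]. Since [L > 0], a singular [M]
    makes the left-hand side infinite, so the inequality contains invertibility. *)
Lemma opnorm_inv_boundP k (M : 'M[R]_k) (L C : R) : psd M -> 0 < L ->
  (L%:E * maxe (opnorm_inv M) 1 <= C%:E)%E <->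
  (L <= C /\ forall v, L * dotmx v v <= C * qform M v).
Proof.
move=> pM L0; rewrite /opnorm_inv.
have eqv (C0 : 0 < C) : (forall v, L * dotmx v v <= C * qform M v) <->
    (forall v, dotmx v v <= C / L * qform M v).
  by split=> H v; have := H v; rewrite mulrAC ler_pdivlMr// mulrC.
split=> [|[LC H]].
  case: ifPn => uM; last by rewrite maxye// gt0_muley ?lte_fin// leye_eq.
  rewrite -EFin_max -EFinM lee_fin => H.
  have LC : L <= C.
    by apply: le_trans H; rewrite -[leLHS]mulr1 ler_pM2l// le_max lexx orbT.
  have C0 : 0 < C by exact: lt_le_trans LC.
  split=> //; apply/(eqv C0)/opnorm_invP => //; first exact: divr_gt0.
  split=> //; rewrite ler_pdivlMr// mulrC; apply: le_trans H.
  by rewrite ler_pM2l// le_max lexx.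
have C0 : 0 < C by exact: lt_le_trans LC.
have [uM aM] := (opnorm_invP pM (divr_gt0 C0 L0)).2 ((eqv C0).1 H).
rewrite uM -EFin_max -EFinM lee_fin mulrC -ler_pdivlMr// ge_max aM.
by rewrite ler_pdivlMr// mul1r.
Qed.

Section events.
Context (d : measure_display) (T : measurableType d) (P : probability T R).
Context (n : nat) (X : 'I_n -> {RV P >-> R}).

Lemma LambdaP q (L : R) w : 0 < L -> calL I phi q = L%:E ->
  Lambda I phi q X w <->
  (L <= cfrak R * n%:R / ln n%:R /\ forall v, L * dotmx v v <=
     cfrak R * n%:R / ln n%:R * qform (Psihat phi q (fun i => X i w)) v).
Proof.
by move=> L0 hL; rewrite /Lambda/= hL; apply: opnorm_inv_boundP => //;
  exact: psd_Psihat.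
Qed.

Lemma measurable_mx_Phihat d' (T' : measurableType d') q (x : T' -> 'I_n -> R) :
  (forall i, measurable_fun setT (fun w => x w i)) ->
  (forall j, measurable_fun setT (phi j)) ->
  measurable_mx (fun w => Phihat phi q (x w)).
Proof.
move=> mx mphi i j; under eq_fun do rewrite mxE.
exact: (measurableT_comp (mphi j) (mx i)).
Qed.

Variable f : R -> R.
Hypothesis hI : is_interval I.
Hypothesis sphi : forall j, square_integrable I (phi j).
Hypothesis ophi : forall j k, dotL2 I (phi j) (phi k) = (j == k)%:R.
Hypothesis mf : measurable_fun [set: R] f.
Hypothesis f0 : forall x, 0 <= f x.
Hypothesis fM : exists M : R, forall x, I x -> f x <= M.

(** Positive definiteness of [Psi] makes the ratio meaningful for nonzero vectors. Once cleared of
    its denominator, the inequality is trivial at 0; linear independence of the basis matches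
    nonzero functions with nonzero vectors. *)
Lemma OmegaP q w : Psi I phi f q \in unitmx ->
  Omega I phi f q X w <->
  forall v, `|qform (Psihat phi q (fun i => X i w)) v - qform (Psi I phi f q) v|
    <= 1 / 2 * qform (Psi I phi f q) v.
Proof.
move=> uP; have ratio (a b : R) : 0 < b ->
    (`|a / b - 1| <= 1 / 2) = (`|a - b| <= 1 / 2 * b).
  move=> b0; rewrite -[RHS](ler_pM2r (_ : 0 < b^-1)) ?invr_gt0//.
  by rewrite mulfK ?gt_eqF// -{2}(gtr0_norm (_ : 0 < b^-1)) ?invr_gt0// -normrM
    mulrBl divff ?gt_eqF.
split=> [H v|H t [c ->] t0].
  have [->|v0] := eqVneq v 0.
    by rewrite !qformE /dotmx !mul0mx mxE subr0 normr0 mulr0.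
  rewrite -ratio; last exact: Psi_qform_gt0.
  rewrite -sqnorm_emp_lincomb -sqnormf_lincomb//; apply: H; first
    by exists (v 0).
  move=> /(lincomb_eq0 hI sphi ophi) v00.
  by move/eqP : v0; apply; apply/rowP => j; rewrite v00 mxE.
pose v : 'rV[R]_q := \row_j c j.
have cv : c = v 0 by apply/funext => j; rewrite mxE.
have v0 : v != 0.
  apply/eqP => vz; apply: t0; apply/funext => u.
  by rewrite cv vz /lincomb big1// => j _; rewrite mxE mul0r.
rewrite cv sqnorm_emp_lincomb sqnormf_lincomb// ratio; first exact: H.
exact: Psi_qform_gt0.
Qed.

End events.

Section projection.
Hypothesis hI : is_interval I.
Hypothesis sphi : forall j, square_integrable I (phi j).
Let mI := measurable_I hI.
Local Notation mu := (@lebesgue_measure R).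

(** Pythagoras: [t \- gm] lies in the span, hence is orthogonal to [g \- gm]. *)
Lemma projection_optimal m (g gm t : R -> R) : square_integrable I g ->
  is_orthogonal_projection I phi m g gm -> calS phi m t ->
  sqnormL2 I (gm \- g) <= sqnormL2 I (t \- g).
Proof.
move=> sg [[c gmE] ort] [c' tE].
have sgm : square_integrable I gm by rewrite gmE;
  exact: square_integrable_lincomb.
have st : square_integrable I t by rewrite tE; exact: square_integrable_lincomb.
have tg : calS phi m (t \- gm).
  exists (fun j => c' j - c j); apply/funext => x.
  rewrite /lincomb tE gmE /= /lincomb -sumrB.
  by apply: eq_bigr => j _; rewrite mulrBl.
have stg := square_integrableB hI st sgm.
have sgg := square_integrableB hI sg sgm.
have i1 := square_integrable_mul hI stg stg.
have i2 := square_integrable_mul hI sgg stg.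
have i3 := square_integrable_mul hI sgg sgg.
have e1 : sqnormL2 I (gm \- g) = sqnormL2 I (g \- gm).
  by rewrite /sqnormL2 /dotL2; apply: eq_Rintegral => x _ /=; ring.
have i12 : mu.-integrable I (EFin \o (fun x =>
  - 2 * ((g \- gm) x * (t \- gm) x))).
  by have := integrableZl (mu := mu) mI (- 2) i2; apply: eq_integrable.
have i123 : mu.-integrable I (EFin \o (fun x =>
  (t \- gm) x * (t \- gm) x + - 2 * ((g \- gm) x * (t \- gm) x))).
  by have := integrableD (mu := mu) mI i1 i12; apply: eq_integrable.
have -> : sqnormL2 I (t \- g) = sqnormL2 I (t \- gm) + sqnormL2 I (g \- gm).
  have := ort _ tg; rewrite /sqnormL2 /dotL2 => o0.
  transitivity (\int[mu]_(x in I) ((t \- gm) x * (t \- gm) x +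
      - 2 * ((g \- gm) x * (t \- gm) x) + (g \- gm) x * (g \- gm) x)).
    by apply: eq_Rintegral => x _ /=; ring.
  rewrite (RintegralD (mu := mu) mI i123 i3) (RintegralD (mu := mu) mI i1 i12).
  by rewrite (RintegralZl (mu := mu) _ mI i2) o0 mulr0 addr0.
by rewrite e1 lerDr; apply: Rintegral_ge0 => x _; rewrite -expr2 sqr_ge0.
Qed.

Lemma projection_le_inf m (g gm : R -> R) : square_integrable I g ->
  is_orthogonal_projection I phi m g gm ->
  sqnormL2 I (gm \- g) <= inf [set sqnormL2 I (t \- g) | t in calS phi m].
Proof.
move=> sg pg; apply: lb_le_inf; first by exists (sqnormL2 I (gm \- g)), gm =>
  //; exact: pg.1.
by move=> _ [t St <-]; exact: projection_optimal pg St.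
Qed.

End projection.
End Links.

(** * Noise and bias *)

Lemma measurable_mx_smoother (R : realType) (d : measure_display)
    (T : measurableType d) n m p (F : T -> 'M[R]_(n, m + p))
    (Delta : 'M[R]_(m, m + p)) : measurable_mx F ->
  measurable_mx (fun w => deriv_smoother (F w) Delta).
Proof.
move=> mF; have mFl : measurable_mx (fun w => lsubmx (F w)).
  by move=> i j; under eq_fun do rewrite mxE; exact: mF.
apply: measurable_mx_mul; last exact: measurable_mx_tr.
apply: measurable_mx_mul; last exact: measurable_mx_cst.
apply: measurable_mx_scale; apply: measurable_mx_mul => //.
apply: measurable_mx_inv; apply: measurable_mx_scale.
by apply: measurable_mx_mul => //; exact: measurable_mx_tr.
Qed.

(** A design point outside the interval gives a zero row of [F]; the response observed there then
    has no influence on the fit. *)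
Lemma deriv_smoother_row0 (R : realType) n m p (F : 'M[R]_(n, m + p))
    (Delta : 'M[R]_(m, m + p)) k i :
  (forall j, F k j = 0) -> deriv_smoother F Delta k i = 0.
Proof.
move=> Fk; have r0 : row k (lsubmx F) = 0.
  by apply/rowP => j; rewrite !mxE Fk.
have -> : deriv_smoother F Delta k i = row k (deriv_smoother F Delta) 0 i.
  by rewrite [RHS]mxE.
rewrite /deriv_smoother /lscoef !row_mul linearZ/= row_mul r0.
by rewrite mul0mx scaler0 !mul0mx mxE.
Qed.

Section SupportedFunctions.
Context (R : realType) (I : set R) (phi : nat -> R -> R).
Hypothesis hI : is_interval I.
Hypothesis sphi : forall j, square_integrable I (phi j).
Hypothesis hphi0 : forall j x, ~ I x -> phi j x = 0.

Definition L2_supported (g : R -> R) : Prop :=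
  (forall x, ~ I x -> g x = 0) /\ square_integrable I g.

Lemma L2_supported_measurable g : L2_supported g -> measurable_fun [set: R] g.
Proof.
move=> [g0 [mg _]]; rewrite (_ : g = g \_ I).
  exact: (measurable_restrictT g (measurable_I hI)).1 mg.
apply/funext => x; rewrite patchE; case: ifPn => // xI.
by rewrite g0// => /mem_set; rewrite (negbTE xI).
Qed.

Lemma L2_supported_lincomb m (c : 'I_m -> R) : L2_supported (lincomb phi c).
Proof.
split; last exact: square_integrable_lincomb.
by move=> x Ix; rewrite /lincomb big1// => j _; rewrite hphi0// mulr0.
Qed.

Lemma L2_supportedB g h : L2_supported g -> L2_supported h ->
  L2_supported (g \- h).
Proof.
move=> [g0 sg] [h0 sh]; split; last exact: square_integrableB.
by move=> x Ix; rewrite /= g0// h0// subrr.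
Qed.

Lemma L2_supported_indic g : square_integrable I g -> L2_supported (g \* \1_I).
Proof.
move=> sg; split.
  by move=> x Ix; rewrite /= indicE memNset// mulr0.
by apply: eq_square_integrable sg => // x xI; rewrite /= indicE xI mulr1.
Qed.

Variable f : R -> R.
Hypothesis fM : exists M : R, forall x, I x -> f x <= M.
Context (d : measure_display) (T : measurableType d) (P : probability T R).
Context (n : nat) (X : 'I_n -> {RV P >-> R}).
Hypothesis Xf : forall i, has_density (X i) f.
Hypothesis n0 : (0 < n)%N.

Lemma design_sq_integral g : L2_supported g ->
  P.-integrable setT (EFin \o (fun w => \sum_i g (X i w) ^+ 2)) /\
  \int[P]_w (\sum_i g (X i w) ^+ 2) = n%:R * sqnormf I f g.
Proof.
move=> Sg; have [mf f0 _] := Xf (Ordinal n0).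
have h i := density_sq_integral hI mf f0 fM (Xf i) (L2_supported_measurable Sg)
  Sg.1 Sg.2.
have [i1 ->] := Rintegral_sum (index_enum 'I_n) measurableT (fun i => (h i).1).
split=> //; under eq_bigr do rewrite (h _).2.
by rewrite sumr_const card_ord mulr_natl.
Qed.

End SupportedFunctions.

Section Main.
Context (R : realType) (d : measure_display) (T : measurableType d).
Context (P : probability T R).
Context (I : set R) (phi : nat -> R -> R) (f : R -> R) (sigma : R).
Hypothesis hI : is_interval I.
Hypothesis sphi : forall j, square_integrable I (phi j).
Hypothesis ophi : forall j k, dotL2 I (phi j) (phi k) = (j == k)%:R.
Hypothesis hphi0 : forall j x, ~ I x -> phi j x = 0.
Hypothesis fM : exists M : R, forall x, I x -> f x <= M.
Context (n m p : nat).
Hypothesis n0 : (0 < n)%N.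
Context (X eps : 'I_n -> {RV P >-> R}).
Hypothesis Xf : forall i, has_density (X i) f.
Hypothesis heps : mutually_independent eps.
Hypothesis heps_mean : forall i, ('E_P[eps i] = 0)%E.
Hypothesis heps_var : forall i, ('V_P[eps i] = (sigma ^+ 2)%:E)%E.
Hypothesis hXeps : independent_families X eps.
Context (Delta : 'M[R]_(m, m + p)).

Let mf : measurable_fun [set: R] f. Proof. by have [] := Xf (Ordinal n0). Qed.
Let f0 x : 0 <= f x. Proof. by have [_ +] := Xf (Ordinal n0); exact. Qed.
Let Pq := Psi I phi f (m + p).
Let Pm := Psi I phi f m.
Hypothesis Pq_unit : Pq \in unitmx.

Let F w := Phihat phi (m + p) (fun i => X i w).
Let H w := deriv_smoother (F w) Delta.
Let Df := sqrtmx Pq *m Delta^T *m invmx (sqrtmx Pm).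

Lemma Pm_unit : Pm \in unitmx.
Proof.
apply: unitmx_qform => c c0; rewrite /Pm -(ulsubmx_Psi _ _ _ _ p) qform_ulsubmx.
apply: Psi_qform_gt0 => //; apply: contra c0 => /eqP c0.
by apply/eqP; have := congr1 lsubmx c0; rewrite row_mxKl linear0.
Qed.

(** What Omega asserts at one outcome, once the ratio of norms is cleared of its denominator. *)
Definition gram_close w : Prop :=
  forall v, `|qform (gram (F w)) v - qform Pq v| <= 1 / 2 * qform Pq v.

Lemma gram_l_unit w : gram_close w -> gram_l (F w) \in unitmx.
Proof.
move=> close; apply: unitmx_qform => c c0; rewrite (qform_gram_l _ n0).
have : 0 < qform Pq (row_mx c 0).
  apply: Psi_qform_gt0 => //; apply: contra c0 => /eqP c0.
  by apply/eqP; have := congr1 lsubmx c0; rewrite row_mxKl linear0.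
have := close (row_mx c 0); rewrite ler_norml => /andP[+ _].
lra.
Qed.

(** When [Delta] represents differentiation, these are the derivatives of the basis obtained from
    the first m functions through Psi_m^{-1/2}, which is orthonormal for the weight f. Their squared
    f-norms add up to the squared Frobenius norm of [Df]. *)
Let tl (l : 'I_m) := lincomb phi ((row l (Delta^T *m invmx (sqrtmx Pm))^T) 0).

Lemma smoother_frob_le w : gram_close w ->
  \sum_i \sum_k H w k i ^+ 2 <= 2 / n%:R * \sum_l \sum_i tl l (X i w) ^+ 2.
Proof.
move=> close; have := @deriv_smoother_frob _ _ _ _ (F w) Delta n0 (gram_l_unit
  close)
  Pq (psd_Psi hI sphi mf f0 fM _).
rewrite ulsubmx_Psi => /(_ Pm_unit close) h; apply: le_trans h _.
rewrite [X in _ * X <= _](_ : _ = \sum_l \sum_i tl l (X i w) ^+ 2)//.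
rewrite [RHS]exchange_big/=; apply: eq_bigr => i _; apply: eq_bigr => l _.
rewrite /tl (lincomb_Phihat phi (fun i => X i w)) -row_mul -trmx_mul mulmxA.
by rewrite !mxE.
Qed.

Context (bI dbI : R -> R) (cb cd : 'rV[R]_m).
Hypothesis Sb : L2_supported I bI.
Hypothesis Sd : L2_supported I dbI.
Let bm := lincomb phi (cb 0).
Let dbm := lincomb phi ((cb *m Delta) 0).
Let dm := lincomb phi (cd 0).

Definition bias w i : R := ((\row_k bI (X k w)) *m H w) 0 i - dbI (X i w).

(** The smoother maps the values of [bm] to those of [dbm], so the bias is the smoother applied to
    [bI \- bm], plus [dbm \- dm], plus [dm \- dbI]. Squaring three terms costs 3 and the bound on
    the smoother another 3, whence 9. *)
Lemma bias_le w : gram_close w ->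
  \sum_i bias w i ^+ 2 <=
    9 * opnorm Df ^+ 2 * (\sum_i (bI \- bm) (X i w) ^+ 2) +
    3 * (\sum_i (dbm \- dm) (X i w) ^+ 2) +
    3 * (\sum_i (dm \- dbI) (X i w) ^+ 2).
Proof.
move=> close; pose r : 'rV[R]_n := \row_k (bI \- bm) (X k w).
have rE : \row_k bI (X k w) = r + cb *m (lsubmx (F w))^T.
  apply/rowP => k; rewrite !mxE.
  have -> : \sum_j cb 0 j * (lsubmx (F w))^T j k = bm (X k w).
    by apply: eq_bigr => j _; rewrite !mxE.
  by rewrite subrK.
have uG := gram_l_unit close.
have E i : bias w i = (r *m H w) 0 i + (dbm \- dm) (X i w) + (dm \- dbI) (X i
  w).
  rewrite /bias rE mulmxDl mxE /H deriv_smootherK// -lincomb_Phihat -/dbm /=.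
  ring.
have := @deriv_smoother_le_Df _ _ _ _ (F w) Delta n0 uG Pq (psd_Psi hI sphi mf
  f0 fM _).
rewrite ulsubmx_Psi => /(_ Pm_unit close r) h.
have rr : dotmx r r = \sum_i (bI \- bm) (X i w) ^+ 2.
  by rewrite dotmxE; apply: eq_bigr => i _; rewrite !mxE expr2.
apply: (@le_trans _ _ (3 * dotmx (r *m H w) (r *m H w) +
    3 * (\sum_i (dbm \- dm) (X i w) ^+ 2) + 3 * (\sum_i (dm \- dbI) (X i w) ^+
      2))).
  rewrite dotmxE !mulr_sumr -!big_split; apply: ler_sum => i _.
  rewrite E; move: (_ 0 i) (_ (X i w)) (_ (X i w)) => x y z /=.
  have := sqr_ge0 (x - y); have := sqr_ge0 (x - z); have := sqr_ge0 (y - z);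
    nra.
by rewrite !lerD2r -rr; move: h; rewrite -/Df -/(H w); lra.
Qed.

(** The indicator of [G] depends on the design only and joins the coefficients, which are then
    dominated at every outcome by sums over the design points: [A] for the noise, [D] for the bias.
    [Z] is a sum and not an average, hence the factor n. *)
Lemma noise_bias_integral (G : set T) : sigma_algebra_of X G ->
  (forall w, G w -> gram_close w) ->
  let Z w := \sum_i (\sum_k \1_G w * H w k i * eps k w + \1_G w * bias w i) ^+
    2 in
  P.-integrable setT (EFin \o Z) /\
  \int[P]_w Z w <= n%:R * (9 * opnorm Df ^+ 2 * sqnormf I f (bI \- bm) +
     3 * sqnormf I f (dbm \- dm) + 3 * sqnormf I f (dm \- dbI) +
     2 * sigma ^+ 2 / n%:R * frobnorm Df ^+ 2).
Proof.
move=> sG Gclose Z.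
pose a i k w := \1_G w * H w k i; pose be i w := \1_G w * bias w i.
have mphi j : measurable_fun [set: R] (phi j).
  by apply: (L2_supported_measurable hI); split; [exact: hphi0|exact: sphi].
have m1 : measurable_fun [set: sigma_type X] (\1_G : sigma_type X -> R).
  exact: measurable_indic.
have mF : @measurable_mx R _ (sigma_type X) _ _ F.
  apply: (@measurable_mx_Phihat R phi n _ (sigma_type X)) => // i.
  exact: sigma_measurable_self.
have mH : @measurable_mx R _ (sigma_type X) _ _ H
  by exact: measurable_mx_smoother.
have sa i k : sigma_measurable X (a i k).
  exact: (@measurable_funM _ (sigma_type X)).
have sbe i : sigma_measurable X (be i).
  apply: (@measurable_funM _ (sigma_type X)) => //.
  apply: (@measurable_funB _ (sigma_type X)); last first.
    by apply: sigma_measurable_comp; exact: (L2_supported_measurable hI Sd).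
  apply: (@measurable_mx_mul R _ (sigma_type X) _ _ _ (fun w =>
    \row_k bI (X k w)) H _ mH 0 i).
  apply: (@measurable_mx_row R _ (sigma_type X)) => k.
  by apply: sigma_measurable_comp; exact: (L2_supported_measurable hI Sb).
have SL k (c : 'I_k -> R) := L2_supported_lincomb hI sphi hphi0 c.
have Stl l : L2_supported I (tl l) by exact: SL.
have dI g := @design_sq_integral _ _ hI _ fM _ _ P _ X Xf n0 g.
pose A w := 2 / n%:R * \sum_l \sum_i tl l (X i w) ^+ 2.
have [iA1 eA1] := Rintegral_sum (index_enum 'I_m) measurableT (fun l =>
  (dI _ (Stl l)).1).
have iA : P.-integrable setT (EFin \o A)
  by have := integrableZl measurableT (2 / n%:R) iA1.
have eA : \int[P]_w A w = 2 * frobnorm Df ^+ 2.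
  rewrite (RintegralZl _ measurableT iA1) eA1.
  under eq_bigr do rewrite (dI _ (Stl _)).2 sqnormf_lincomb//.
  rewrite -mulr_sumr mulrA mulfVK ?pnatr_eq0 -?lt0n//; congr (_ * _).
  rewrite sqr_frobnorm exchange_big/=; apply: eq_bigr => l _.
  have [[sS _] _] := sqrtmxP (psd_Psi hI sphi mf f0 fM (m + p)).
  rewrite qform_sqrtmx; last exact: psd_Psi.
  rewrite dotmxE -row_mul -{1 2}sS -trmx_mul; apply: eq_bigr => j _.
  by rewrite /Df -mulmxA !mxE expr2.
have iB1 := dI _ (L2_supportedB hI Sb (SL _ (cb 0))).
have iB2 := dI _ (L2_supportedB hI (SL _ ((cb *m Delta) 0)) (SL _ (cd 0))).
have iB3 := dI _ (L2_supportedB hI (SL _ (cd 0)) Sd).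
pose D w := 9 * opnorm Df ^+ 2 * (\sum_i (bI \- bm) (X i w) ^+ 2) +
    3 * (\sum_i (dbm \- dm) (X i w) ^+ 2) +
    3 * (\sum_i (dm \- dbI) (X i w) ^+ 2).
have i1 := integrableZl measurableT (9 * opnorm Df ^+ 2) iB1.1.
have i2 := integrableZl measurableT 3 iB2.1.
have i3 := integrableZl measurableT 3 iB3.1.
have i12 := integrableD measurableT i1 i2.
have i123 := integrableD measurableT i12 i3.
have iD : P.-integrable setT (EFin \o D) by apply: integrable_eqfun i123.
have eD : \int[P]_w D w = n%:R * (9 * opnorm Df ^+ 2 * sqnormf I f (bI \- bm) +
     3 * sqnormf I f (dbm \- dm) + 3 * sqnormf I f (dm \- dbI)).
  rewrite (RintegralD measurableT i12 i3) (RintegralD measurableT i1 i2).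
  rewrite (RintegralZl _ measurableT iB1.1) (RintegralZl _ measurableT iB2.1).
  by rewrite (RintegralZl _ measurableT iB3.1) iB1.2 iB2.2 iB3.2; ring.
have A0 w : 0 <= A w.
  rewrite mulr_ge0 ?divr_ge0// sumr_ge0// => l _.
  by rewrite sumr_ge0// => i _; exact: sqr_ge0.
have D0 w : 0 <= D w.
  have S0 (g : R -> R) : 0 <= \sum_i g (X i w) ^+ 2 by rewrite sumr_ge0// =>
    i _; exact: sqr_ge0.
  apply: addr_ge0; first apply: addr_ge0; apply: mulr_ge0 => //.
  by apply: mulr_ge0 => //; exact: sqr_ge0.
(* Off [G] the left-hand side is 0, so the bound holds at every outcome. *)
have leA w : \sum_i \sum_k a i k w ^+ 2 <= A w.
  rewrite /a indicE; have [/set_mem Gw|_] := boolP (w \in G).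
    under eq_bigr do under eq_bigr do rewrite mul1r.
    exact: smoother_frob_le (Gclose _ Gw).
  rewrite big1 ?A0// => i _; rewrite big1// => k _.
  by rewrite mul0r expr0n.
have leD w : \sum_i be i w ^+ 2 <= D w.
  rewrite /be indicE; have [/set_mem Gw|_] := boolP (w \in G).
    under eq_bigr do rewrite mul1r.
    exact: bias_le (Gclose _ Gw).
  by rewrite big1 ?D0// => i _; rewrite mul0r expr0n.
have iaa i k : P.-integrable setT (EFin \o (fun w => a i k w ^+ 2)).
  apply: (le_integrable measurableT _ _ iA).
    by apply/measurable_EFinP; apply: measurable_funX;
      exact: sigma_measurable_fun (sa i k).
  move=> w _; rewrite !abse_EFin lee_fin ger0_norm ?sqr_ge0// ger0_norm//.
  apply: le_trans (leA w); rewrite (bigD1 i)//= (bigD1 k)//= -addrA lerDl.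
  by rewrite addr_ge0// sumr_ge0// => j _; rewrite ?sqr_ge0// sumr_ge0// =>
    l _; exact: sqr_ge0.
have ibb i : P.-integrable setT (EFin \o (fun w => be i w ^+ 2)).
  apply: (le_integrable measurableT _ _ iD).
    by apply/measurable_EFinP; apply: measurable_funX;
      exact: sigma_measurable_fun (sbe i).
  move=> w _; rewrite !abse_EFin lee_fin ger0_norm ?sqr_ge0// ger0_norm//.
  apply: le_trans (leD w); rewrite (bigD1 i)//= lerDl.
  by rewrite sumr_ge0// => j _; rewrite sqr_ge0.
have nq i := noise_quadratic heps heps_mean heps_var hXeps (sa i) (sbe i) (iaa
  i) (ibb i).
have [iZ eZ] := Rintegral_sum (index_enum 'I_n) measurableT (fun i => (nq i).1).
split; first exact: iZ.
rewrite [X in X <= _]eZ; under eq_bigr do rewrite (nq _).2.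
have ra i := Rintegral_sum (index_enum 'I_n) measurableT (iaa i).
have [iaS eaS] := Rintegral_sum (index_enum 'I_n) measurableT (fun i =>
  (ra i).1).
have [ibS ebS] := Rintegral_sum (index_enum 'I_n) measurableT ibb.
rewrite big_split/= -mulr_sumr -ebS; under eq_bigr do rewrite -(ra _).2.
rewrite -eaS.
have hA : \int[P]_w (\sum_i \sum_k a i k w ^+ 2) <= 2 * frobnorm Df ^+ 2.
  by rewrite -eA; apply: le_Rintegral => // w _; exact: leA.
have hD := le_Rintegral measurableT ibS iD (fun w _ => leD w).
rewrite eD in hD.
rewrite mulrDr addrC lerD//.
rewrite (_ : n%:R * _ = sigma ^+ 2 * (2 * frobnorm Df ^+ 2)).
  by rewrite ler_wpM2l ?sqr_ge0.
by field; rewrite pnatr_eq0 -lt0n.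
Qed.

End Main.

(** * The two events depend on the design only *)

Section EventMeasurability.
Context (R : realType) (d : measure_display) (T : measurableType d).
Context (P : probability T R) (I : set R) (phi : nat -> R -> R).
Context (n : nat) (X : 'I_n -> {RV P >-> R}).
Hypothesis mphi : forall j, measurable_fun [set: R] (phi j).

Lemma sigma_measurable_Psihat q :
  @measurable_mx R _ (sigma_type X) _ _ (fun w => Psihat phi q (fun i =>
    X i w)).
Proof.
have mF : @measurable_mx R _ (sigma_type X) _ _ (fun w =>
  Phihat phi q (fun i => X i w)).
  apply: (@measurable_mx_Phihat R phi n _ (sigma_type X)) => // i.
  exact: sigma_measurable_self.
apply: (@measurable_mx_scale R _ (sigma_type X)).
by apply: (@measurable_mx_mul R _ (sigma_type X)) => //;
  exact: measurable_mx_tr.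
Qed.

(** Given [L <= C], the event says that C Psihat - L Id is positive semidefinite. *)
Lemma sigma_algebra_Lambda q (L : R) : 0 < L -> calL I phi q = L%:E ->
  L <= cfrak R * n%:R / ln n%:R -> sigma_algebra_of X (Lambda I phi q X).
Proof.
move=> L0 hL LC; set C := _ / _ in LC.
have := @measurable_qform_ge0 R _ (sigma_type X) _
  (fun w => C *: Psihat phi q (fun i => X i w) - L *: 1%:M)
  (measurable_mx_sub (measurable_mx_scale C (@sigma_measurable_Psihat q))
    (measurable_mx_cst _)).
set A := [set w | _] => mA; suff -> : Lambda I phi q X = A by exact: mA.
apply/seteqP; split => w.
  move=> /(LambdaP X w L0 hL)[_ H]; rewrite /A/= => v.
  by rewrite qformBm (qformZm _ C) (qformZm _ L) qform1 subr_ge0 H.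
rewrite /A/= => H; apply/(LambdaP X w L0 hL); split=> // v.
by have := H v; rewrite qformBm (qformZm _ C) (qformZm _ L) qform1 subr_ge0.
Qed.

Variable f : R -> R.
Hypothesis hI : is_interval I.
Hypothesis sphi : forall j, square_integrable I (phi j).
Hypothesis ophi : forall j k, dotL2 I (phi j) (phi k) = (j == k)%:R.
Hypothesis mf : measurable_fun [set: R] f.
Hypothesis f0 : forall x, 0 <= f x.
Hypothesis fM : exists M : R, forall x, I x -> f x <= M.

(** The absolute value splits into semidefiniteness of (3/2) Psi - Psihat and of Psihat - (1/2)
    Psi. *)
Lemma sigma_algebra_Omega q : Psi I phi f q \in unitmx ->
  sigma_algebra_of X (Omega I phi f q X).
Proof.
move=> uP; set Ps := Psi I phi f q in uP *.
have m1 := @measurable_qform_ge0 R _ (sigma_type X) _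
  (fun w => (3 / 2) *: Ps - Psihat phi q (fun i => X i w))
  (measurable_mx_sub (measurable_mx_cst _) (@sigma_measurable_Psihat q)).
have m2 := @measurable_qform_ge0 R _ (sigma_type X) _
  (fun w => Psihat phi q (fun i => X i w) - (1 / 2) *: Ps)
  (measurable_mx_sub (@sigma_measurable_Psihat q) (measurable_mx_cst _)).
have := @measurableI _ (sigma_type X) _ _ m1 m2.
set A := _ `&` _ => mA; suff -> : Omega I phi f q X = A by exact: mA.
apply/seteqP; split => w.
  move=> /(OmegaP X hI sphi ophi mf f0 fM w uP) H; rewrite /A/=; split=> v.
    by have := H v; rewrite qformBm (qformZm _ (3 / 2)) -/Ps ler_norml =>
      /andP[_]; lra.
  by have := H v; rewrite qformBm (qformZm _ (1 / 2)) -/Ps ler_norml =>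
    /andP[+ _]; lra.
move=> [H1 H2]; apply/(OmegaP X hI sphi ophi mf f0 fM w uP) => v.
have := H1 v; have := H2 v.
rewrite !qformBm (qformZm _ (3 / 2)) (qformZm _ (1 / 2)) -/Ps ler_norml =>
  h1 h2.
by apply/andP; split; lra.
Qed.

End EventMeasurability.

Lemma derivable_measurable (R : realType) (b : R -> R) :
  (forall x, derivable b x 1) -> measurable_fun [set: R] b.
Proof.
move=> hb; apply: continuous_measurable_fun => x.
by apply/differentiable_continuous/derivable1_diffP.
Qed.

(** * Moments common to all observations *)

Section Moments4.
Context (R : realType) (d : measure_display) (T : measurableType d).
Context (P : probability T R) (n : nat) (X eps : 'I_n -> {RV P >-> R}).

(** An even power is nonnegative, so its integral, finite or not, depends only on the joint law of
    [X i] and [eps i], a product of marginals that are the same for all [i]. This extends the moment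
    assumption on the first response to all of them. *)
Lemma response_moment (f b : R -> R) (r : nat) : measurable_fun [set: R] b ->
  iid_density X f -> iid eps -> independent_families X eps -> ~~ odd r ->
  forall i j, (\int[P]_w (response b X eps i w ^+ r)%:E =
               \int[P]_w (response b X eps j w ^+ r)%:E)%E.
Proof.
move=> mb [_ Xf] [_ idE] XE er i j.
pose h (z : R * R) := ((b z.1 + z.2) ^+ r)%:E.
apply: (@eq_ge0_integral_joint _ _ _ P (X i) (eps i) (X j) (eps j) h).
- by apply: (sigma_independent_rv XE); exact: sigma_measurable_self.
- by apply: (sigma_independent_rv XE); exact: sigma_measurable_self.
- move=> A mA; have [_ _ /(_ A mA) Xi] := Xf i; have [_ _ /(_ A mA) Xj] := Xf j.
  by rewrite -[LHS]/(distribution P (X i) A) Xi -Xj.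
- by move=> A mA; exact: idE.
- apply/measurable_EFinP; apply: measurable_funX; apply: measurable_funD => //.
  exact: (measurableT_comp mb).
- by move=> z; rewrite lee_fin exprn_even_ge0.
Qed.

Lemma design_moment (f g : R -> R) (r : nat) : measurable_fun [set: R] g ->
  (forall i, has_density (X i) f) -> ~~ odd r ->
  forall i j, (\int[P]_w (g (X i w) ^+ r)%:E = \int[P]_w (g (X j w) ^+ r)%:E)%E.
Proof.
move=> mg Xf er i j.
have mgr : measurable_fun [set: R] (fun x => g x ^+ r)
  by exact: measurable_funX.
have g0 x : 0 <= g x ^+ r by exact: exprn_even_ge0.
by rewrite (ge0_integral_density (Xf i) mgr g0) (ge0_integral_density (Xf j)
  mgr g0).
Qed.

End Moments4.

Lemma sqnorm_emp_db_hat (R : realType) (I : set R) (phi : nat -> R -> R)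
    n m p (x y : 'I_n -> R) (Delta : 'M[R]_(m, m + p)) (g : R -> R) (s : R) :
  (forall (j : 'I_m) (u : R),
     deriv_on I (phi j) u = \sum_(k < m + p) Delta j k * phi k u) ->
  sqnorm_emp x (fun u => db_hat I phi m x y u * s - g u) =
  n%:R^-1 * \sum_i (((\row_k y k) *m
    deriv_smoother (Phihat phi (m + p) x) Delta) 0 i * s - g (x i)) ^+ 2.
Proof.
move=> hD; congr (_ * _); apply: eq_bigr => i _.
by rewrite (db_hat_smoother x y i hD).
Qed.

(** Design points outside [I] give zero rows of [H], so b may be replaced by its restriction to
    [I]. *)
Lemma smoother_response (R : realType) (I : set R) (phi : nat -> R -> R)
    n m p (x e : 'I_n -> R) (b : R -> R) (Delta : 'M[R]_(m, m + p)) i :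
  (forall j u, ~ I u -> phi j u = 0) ->
  let H := deriv_smoother (Phihat phi (m + p) x) Delta in
  ((\row_k (b (x k) + e k)) *m H) 0 i =
  \sum_k H k i * e k + ((\row_k (b \* \1_I) (x k)) *m H) 0 i.
Proof.
move=> hphi0 H; have H0 k : ~ I (x k) -> H k i = 0.
  by move=> xI; apply: deriv_smoother_row0 => j; rewrite mxE hphi0.
clearbody H; rewrite !mxE -big_split/=; apply: eq_bigr => k _; rewrite !mxE.
rewrite indicE; have [_|xI] := boolP (x k \in I); first by rewrite mulr1; ring.
rewrite H0 ?mulr0 ?mul0r ?addr0// => /mem_set.
by rewrite (negbTE xI).
Qed.

(** [L] is positive because the first basis function is nonzero somewhere on [I]; the stability
    inequality then makes [Psi] positive definite. *)
Lemma stable_Psi (R : realType) (I : set R) (phi : nat -> R -> R) (f : R -> R)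
    (q n : nat) : is_interval I -> (forall j, square_integrable I (phi j)) ->
  (forall j k, dotL2 I (phi j) (phi k) = (j == k)%:R) ->
  measurable_fun [set: R] f -> (forall x, 0 <= f x) ->
  (exists M : R, forall x, I x -> f x <= M) -> (0 < q)%N ->
  (calL I phi q < +oo)%E -> stable I phi f q n ->
  exists L, [/\ 0 < L, calL I phi q = L%:E,
    L <= cfrak R * n%:R / ln n%:R & Psi I phi f q \in unitmx].
Proof.
move=> hI sphi ophi mf f0 fM q0 Loo st.
have [x Ix px] := basis_point hI ophi 0.
have Lge : (calL I phi q >= (\sum_(j < q) phi j x ^+ 2)%:E)%E.
  by apply: ereal_sup_ubound; exists x.
have S0 : 0 < \sum_(j < q) phi j x ^+ 2.
  rewrite (bigD1 (Ordinal q0))//= ltr_pwDl ?sumr_ge0// => [|j _];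
    last exact: sqr_ge0.
  by rewrite lt_neqAle sqr_ge0 eq_sym sqrf_eq0 px.
have Lfin : calL I phi q \is a fin_num.
  by rewrite ge0_fin_numE// (calL_fin_ge0 _ _ Ix).
exists (fine (calL I phi q)); have LE := esym (fineK Lfin).
have L0 : 0 < fine (calL I phi q).
  by rewrite -lte_fin fineK// (lt_le_trans _ Lge).
move: st; rewrite /stable LE =>
  /(opnorm_inv_boundP _ (psd_Psi hI sphi mf f0 fM q) L0)[LC H].
split=> //.
  (* Stability is assumed with half the constant that defines Lambda. *)
  have -> : cfrak R * n%:R / ln n%:R = 2 * (cfrak R / 2 * (n%:R / ln n%:R)).
    by move: (ln n%:R)^-1 => l; field.
  by lra.
have C0 := lt_le_trans L0 LC.
apply: unitmx_qform => v v0; rewrite -(pmulr_rgt0 _ C0);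
  apply: lt_le_trans (H v).
by rewrite mulr_gt0// lt_neqAle eq_sym dotmxvv_eq0 v0 dotmxvv_ge0.
Qed.

Theorem proposition3p8 (R : realType) (d : measure_display)
    (T : measurableType d) (P : probability T R)
    (I : set R) (phi : nat -> R -> R) (f b : R -> R) (sigma c81 : R)
    (* interval and basis *)
    (hI : is_interval I)
    (hphi : hilbert_basis I phi)
    (hphi_diff : forall j, derivable_on I (phi j))
    (hphi0 : forall j x, ~ I x -> phi j x = 0)
    (* regression function, with b and b' square integrable on I *)
    (hb : forall x, derivable b x 1)
    (hb' : continuous (derive1 b))
    (hb2 : square_integrable I b)
    (hb'2 : square_integrable I (derive1 b))
    (hc81 : deviation_constant P I phi f c81)
    (* observations *)
    (n m p : nat) (hn : (1 < n)%N) (hm : (0 < m)%N)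
    (X eps : 'I_n -> {RV P >-> R})
    (hX : iid_density X f)
    (heps : iid eps)
    (heps_mean : forall i, ('E_P[eps i] = 0)%E)
    (heps_var : forall i, ('V_P[eps i] = (sigma ^+ 2)%:E)%E)
    (hXeps : independent_families X eps) :
  let Y := response b X eps in
  let bI : R -> R := b \* \1_I in
  let dbI : R -> R := (derive1 b) \* \1_I in
  (exists M : R, forall x, I x -> f x <= M) ->
  (forall j : nat, (j < m)%N -> calS phi (j.+1 + p) (deriv_on I (phi j))) ->
  (calL I phi (m + p) < +oo)%E ->
  stable I phi f (m + p) n ->
  ('E_P[fun w => (dbI (X (first hn) w) ^+ 4)%R] < +oo)%E ->
  ('E_P[fun w => (Y (first hn) w ^+ 4)%R] < +oo)%E ->
  forall (Delta : 'M[R]_(m, m + p)) (bm dbI_m : R -> R),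
  (forall (j : 'I_m) (x : R),
     deriv_on I (phi j) x = \sum_(k < m + p) Delta j k * phi k x) ->
  is_orthogonal_projection I phi m bI bm ->
  is_orthogonal_projection I phi m dbI dbI_m ->
  let Deltaf1 := sqrtmx (Psi I phi f (m + p)) *m Delta^T *m
                   invmx (sqrtmx (Psi I phi f m)) in
  ('E_P[fun w => sqnorm_emp (fun i => X i w)
                   (db_tilde I phi m p X Y w \- dbI)%R] <=
   (3 * sup [set f x | x in I] *
        inf [set sqnormL2 I (t \- dbI) | t in calS phi m]
    + 9 * opnorm Deltaf1 ^+ 2 * sqnormf I f (bI \- bm)
    + 3 * sqnormf I f (deriv_on I bm \- dbI_m)
    + 2 * sigma ^+ 2 / n%:R * frobnorm Deltaf1 ^+ 2
    + (2 * cfrak R * n%:R / ln n%:R * opnorm Delta ^+ 2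
         * Num.sqrt (fine 'E_P[fun w => (Y (first hn) w ^+ 4)%R]%E)
       + 3 * Num.sqrt (fine 'E_P[fun w => (dbI (X (first hn) w) ^+ 4)%R]%E))
      * (Num.sqrt c81 / n%:R ^+ 4))%:E)%E.
Proof.
move=> Y bI dbI fM _ Loo st d4 Y4 Delta bm dbI_m hDelta pb pd; cbv zeta.
set Df := sqrtmx (Psi I phi f (m + p)) *m Delta^T *m invmx (sqrtmx (Psi I phi f
  m)).
have [sphi ophi _] := hphi.
have Xf := hX.2.
have n0 : (0 < n)%N by exact: ltnW.
have nR : 0 < (n%:R : R) by rewrite ltr0n.
have [mf f0 _] := Xf (first hn).
have q0 : (0 < m + p)%N by rewrite addn_gt0 hm.
have [L [L0 hL LC uP]] := stable_Psi hI sphi ophi mf f0 fM q0 Loo st.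
set C := cfrak R * n%:R / ln n%:R in LC.
have C0 : 0 < C := lt_le_trans L0 LC.
have mb : measurable_fun [set: R] b by exact: derivable_measurable.
have mphi j : measurable_fun [set: R] (phi j).
  by apply: (L2_supported_measurable hI); split; [exact: hphi0|exact: sphi].
have SbI : L2_supported I bI by exact: L2_supported_indic.
have SdbI : L2_supported I dbI by exact: L2_supported_indic.
have mdbI := L2_supported_measurable hI SdbI.
set Lam := Lambda I phi (m + p) X.
set Om := Omega I phi f (m + p) X.
have sLam : sigma_algebra_of X Lam by exact: sigma_algebra_Lambda LC.
have sOm : sigma_algebra_of X Om by exact: sigma_algebra_Omega.
have mLam : measurable Lam := sigma_algebra_of_measurable sLam.
have mOm : measurable Om := sigma_algebra_of_measurable sOm.
have [c0 /(_ (m + p)%N n X q0 hn hX st)[PO PL]] := hc81.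
have r0 : 0 < c81 / n%:R ^+ 8 by rewrite divr_gt0// exprn_gt0.
(* Origin of n^-4: Cauchy-Schwarz takes the square root of a probability bound in n^-8. *)
have sqrtr : Num.sqrt (c81 / n%:R ^+ 8) = Num.sqrt c81 / n%:R ^+ 4.
  have -> : n%:R ^+ 8 = (n%:R ^+ 4) ^+ 2 :> R by rewrite -exprM.
  by rewrite sqrtrM ?(ltW c0)// sqrtrV ?sqr_ge0// sqrtr_sqr ger0_norm//.
pose F w := Phihat phi (m + p) (fun i => X i w).
pose H w := deriv_smoother (F w) Delta.
pose K := C * opnorm Delta ^+ 2.
have K0 : 0 <= K by rewrite mulr_ge0 ?sqr_ge0// ltW.
have mY i : measurable_fun [set: T] (Y i).
  by apply: measurable_funD => //; exact: (measurableT_comp mb).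
have mdX i : measurable_fun [set: T] (fun w => dbI (X i w)).
  exact: (measurableT_comp mdbI).
have [cb bmE] := pb.1; have [cd dmE] := pd.1.
pose rb : 'rV[R]_m := \row_j cb j; pose rd : 'rV[R]_m := \row_j cd j.
have bmE' : bm = lincomb phi (rb 0).
  by rewrite bmE; congr lincomb; apply/funext => j; rewrite mxE.
have dmE' : dbI_m = lincomb phi (rd 0).
  by rewrite dmE; congr lincomb; apply/funext => j; rewrite mxE.
have dbmE : deriv_on I bm = lincomb phi ((rb *m Delta) 0).
  apply/funext => x; rewrite bmE' (deriv_on_lincomb hI)//; last first.
    by move=> y; exact: basis_nondegenerate.
  under eq_bigr do rewrite hDelta mulr_sumr.
  rewrite exchange_big; apply: eq_bigr => k _ /=; rewrite mxE mulr_suml.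
  by apply: eq_bigr => j _; rewrite mulrA.
pose G := Lam `&` Om.
have sG : sigma_algebra_of X G.
  exact: (@measurableI _ (sigma_type X)).
have OmP w : Om w -> gram_close I phi f m p X w.
  by move=> /(OmegaP X hI sphi ophi mf f0 fM w uP); exact.
have [iZ eZ] := noise_bias_integral hI sphi hphi0 fM n0 Xf heps.1 heps_mean
  heps_var
  hXeps Delta uP rb rd SbI SdbI sG (fun w Gw => OmP w Gw.2).
set Z := (fun w => _) in iZ eZ.
pose y4 := Num.sqrt (fine (\int[P]_w (Y (first hn) w ^+ 4)%:E)%E).
pose z4 := Num.sqrt (fine (\int[P]_w (dbI (X (first hn) w) ^+ 4)%:E)%E).
pose rr := Num.sqrt c81 / n%:R ^+ 4.
(* Moments of observation [i] are exchanged with those of the first, the only ones in the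
   hypotheses. *)
have csY i : P.-integrable setT (fun w => (Y i w ^+ 2 * \1_(~` Om) w)%:E) /\
    \int[P]_w (Y i w ^+ 2 * \1_(~` Om) w) <= y4 * rr.
  rewrite /y4 -(@response_moment _ _ _ P n X eps f b 4 mb hX heps hXeps isT i).
  rewrite /rr -sqrtr; apply: event_cauchy_schwarz => //;
    first exact: measurableC.
  rewrite (@response_moment _ _ _ P n X eps f b 4 mb hX heps hXeps isT i (first
    hn)).
  by move: Y4; rewrite expectation.unlock.
have csd (A : set T) i : measurable A -> (P A <= (c81 / n%:R ^+ 8)%:E)%E ->
    P.-integrable setT (fun w => (dbI (X i w) ^+ 2 * \1_A w)%:E) /\
    \int[P]_w (dbI (X i w) ^+ 2 * \1_A w) <= z4 * rr.
  move=> mA PA; rewrite /z4 -(@design_moment _ _ _ P n X f dbI 4 mdbI Xf isT i).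
  rewrite /rr -sqrtr; apply: event_cauchy_schwarz => //.
  rewrite (@design_moment _ _ _ P n X f dbI 4 mdbI Xf isT i (first hn)).
  by move: d4; rewrite expectation.unlock.
have csO i := csd (~` Om) i (measurableC mOm) PO.
have csL i := csd (~` Lam) i (measurableC mLam) PL.
(* Remainder off [G]. On Lambda outside Omega, (u - v)^2 <= 2 u^2 + 2 v^2 and [K] bounds the squared
   norm of the smoother; outside Lambda the estimator is 0 and only the square of b' remains. The
   coefficient of [z4] is thus 2 + 1 = 3. *)
pose W i w := 2 * K * (Y i w ^+ 2 * \1_(~` Om) w) +
  2 * (dbI (X i w) ^+ 2 * \1_(~` Om) w) + dbI (X i w) ^+ 2 * \1_(~` Lam) w.
have W0 i w : 0 <= W i w.
  have e0 (x : R) (A : set T) : 0 <= x ^+ 2 * \1_A w.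
    by apply: mulr_ge0; [exact: sqr_ge0|rewrite indicE].
  apply: addr_ge0 => //; apply: addr_ge0; apply: mulr_ge0 => //.
  exact: mulr_ge0.
have iW i : P.-integrable setT (EFin \o W i) /\
    \int[P]_w W i w <= (2 * K * y4 + 3 * z4) * rr.
  have j1 := integrableZl measurableT (2 * K) (csY i).1.
  have j2 := integrableZl measurableT 2 (csO i).1.
  have j12 := integrableD measurableT j1 j2.
  split; first by apply: integrable_eqfun (integrableD measurableT j12 (csL
    i).1).
  rewrite (RintegralD measurableT j12 (csL i).1) (RintegralD measurableT j1 j2).
  rewrite (RintegralZl _ measurableT (csY i).1) (RintegralZl _ measurableT (csO
    i).1).
  apply: (@le_trans _ _ (2 * K * (y4 * rr) + 2 * (z4 * rr) + z4 * rr)).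
    apply: lerD; last exact: (csL i).2.
    apply: lerD; last by rewrite ler_pM2l//; exact: (csO i).2.
    by apply: ler_wpM2l; [rewrite mulr_ge0|exact: (csY i).2].
  by rewrite le_eqVlt; apply/orP; left; apply/eqP; ring.
have [iWS eWS] := Rintegral_sum (index_enum 'I_n) measurableT (fun i =>
  (iW i).1).
pose S w := sqnorm_emp (fun i => X i w) (db_tilde I phi m p X Y w \- dbI)%R.
have SE w : S w = n%:R^-1 * \sum_i (((\row_k Y k w) *m H w) 0 i * \1_Lam w -
  dbI (X i w)) ^+ 2.
  exact: (sqnorm_emp_db_hat (fun i => X i w) (fun i =>
    Y i w) dbI (\1_Lam w) hDelta).
have LamP w : Lam w -> forall v, L * dotmx v v <= C * qform (gram (F w)) v.
  by move=> /(LambdaP X w L0 hL)[_].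
have Z0 w : 0 <= Z w by rewrite sumr_ge0// => i _; exact: sqr_ge0.
have key w : S w <= n%:R^-1 * (Z w + \sum_i W i w).
  rewrite SE ler_pM2l ?invr_gt0//.
  have [Lw|Lw] := pselect (Lam w); last first.
    apply: (@le_trans _ _ (\sum_i W i w)); last by rewrite lerDr.
    apply: ler_sum => i _; rewrite indicE memNset// mulr0 sub0r sqrrN.
    rewrite /W (_ : \1_(~` Lam) w = 1); last by rewrite indicE mem_set.
    rewrite mulr1 lerDr; have := W0 i w.
    have e0 (x : R) (A : set T) : 0 <= x ^+ 2 * \1_A w.
      by apply: mulr_ge0; [exact: sqr_ge0|rewrite indicE].
    by move=> _; apply: addr_ge0; apply: mulr_ge0 => //; exact: mulr_ge0.
  have L1 : \1_Lam w = 1 :> R by rewrite indicE mem_set.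
  have [Ow|Ow] := pselect (Om w).
    (* On [G] the loss is exactly the noise plus bias sum [Z], up to the factor 1/n. *)
    have G1 : \1_G w = 1 :> R by rewrite indicE mem_set.
    apply: (@le_trans _ _ (Z w)); last by rewrite lerDl sumr_ge0.
    rewrite le_eqVlt; apply/orP; left; apply/eqP; apply: eq_bigr => i _.
    rewrite L1 G1 mulr1 mul1r /bias addrA; congr ((_ - _) ^+ 2).
    rewrite (smoother_response (fun k => X k w) (fun k =>
      eps k w) b Delta i hphi0).
    by congr (_ + _); apply: eq_bigr => k _; rewrite mul1r.
  (* Without Omega, invertibility at level m comes from Lambda, through its lower bound at
     zero-padded vectors and [L > 0]. *)
  have gU : gram_l (F w) \in unitmx.
    apply: unitmx_qform => c cn; rewrite (qform_gram_l _ n0) -(pmulr_rgt0 _ C0).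
    apply: lt_le_trans (LamP w Lw _); rewrite mulr_gt0// lt_neqAle dotmxvv_ge0.
    rewrite eq_sym dotmxvv_eq0 andbT; apply: contra cn => /eqP c00.
    by apply/eqP; have := congr1 lsubmx c00; rewrite row_mxKl linear0.
  pose y : 'rV[R]_n := \row_k Y k w.
  have yH := @deriv_smoother_le _ _ _ _ (F w) Delta n0 gU L C y (ltW L0)
    (fun v => qform_Psihat_le (fun i =>
      X i w) v (ltW L0) n0 hphi0 hL) (LamP w Lw) (ltW C0).
  apply: (@le_trans _ _ (\sum_i W i w)); last by rewrite lerDr.
  apply: (@le_trans _ _ (2 * dotmx (y *m H w) (y *m H w) + 2 * \sum_i dbI (X i
    w) ^+ 2)).
    rewrite dotmxE !mulr_sumr -big_split; apply: ler_sum => i _.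
    rewrite L1 mulr1 /=; move: (_ 0 i) (dbI _) => u v.
    by have := sqr_ge0 (u + v); nra.
  rewrite /W; under [leRHS]eq_bigr => i _.
    rewrite (_ : \1_(~` Om) w = 1); last by rewrite indicE mem_set.
    rewrite !mulr1; over.
  rewrite !big_split/= -!mulr_sumr -addrA lerD//.
    rewrite -mulrA ler_pM2l//; apply: le_trans yH _.
    by rewrite dotmxE; under eq_bigr do rewrite !mxE -expr2.
  rewrite lerDl sumr_ge0// => i _.
  by apply: mulr_ge0; [exact: sqr_ge0|rewrite indicE].
have mS : measurable_fun [set: T] S.
  rewrite (funext SE); apply: measurable_funM => //; apply: measurable_sum => i.
  apply: measurable_funX; apply: measurable_funB => //.
  apply: measurable_funM; last exact: measurable_indic.
  apply: (measurable_mx_mul (M := fun w => \row_k Y k w) (N := H)).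
    exact: measurable_mx_row.
  apply: measurable_mx_smoother.
  by apply: (measurable_mx_Phihat (x := fun w i => X i w)).
have iZW : P.-integrable setT (EFin \o (fun w => Z w + \sum_i W i w)).
  exact: (integrableD measurableT iZ iWS).
have iB : P.-integrable setT (EFin \o (fun w =>
  n%:R^-1 * (Z w + \sum_i W i w))).
  exact: (integrableZl measurableT n%:R^-1 iZW).
have eB : \int[P]_w (n%:R^-1 * (Z w + \sum_i W i w)) =
    n%:R^-1 * (\int[P]_w Z w + \sum_i \int[P]_w W i w).
  by rewrite (RintegralZl _ measurableT iZW) (RintegralD measurableT iZ iWS)
    eWS.
rewrite expectation.unlock -[X in (X <= _)%E]/(\int[P]_w (S w)%:E)%E.
apply: (@le_trans _ _ (\int[P]_w (n%:R^-1 * (Z w + \sum_i W i w))%:E)%E).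
  apply: ge0_le_integral => //.
  - move=> w _; rewrite lee_fin SE mulr_ge0 ?invr_ge0// sumr_ge0// => i _.
    exact: sqr_ge0.
  - exact/measurable_EFinP.
  - by move/measurable_int : iB.
  - by move=> w _; rewrite lee_fin.
rewrite -(fineK (integrable_fin_num measurableT iB)) lee_fin.
rewrite -[X in X <= _]/(\int[P]_w (n%:R^-1 * (Z w + \sum_i W i w))) eB.
have sumW : \sum_i \int[P]_w W i w <= n%:R * ((2 * K * y4 + 3 * z4) * rr).
  apply: (@le_trans _ _ (\sum_(i < n) ((2 * K * y4 + 3 * z4) * rr))).
    by apply: ler_sum => i _; exact: (iW i).2.
  by rewrite sumr_const card_ord [leRHS]mulr_natl.
rewrite -(ler_pM2l nR) mulrA divff ?gt_eqF// mul1r.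
apply: le_trans (lerD eZ sumW) _;
  rewrite -mulrDr ler_pM2l// -bmE' -dmE' -dbmE -/Df.
(* The projection is optimal for the unweighted norm, so the weight is first bounded by its
   supremum; a point of [I] shows that this supremum is nonnegative. *)
have projd : sqnormf I f (dbI_m \- dbI) <=
    sup [set f x | x in I] * inf [set sqnormL2 I (t \- dbI) | t in calS phi m].
  have sd : square_integrable I (dbI_m \- dbI).
    apply: (square_integrableB hI _ SdbI.2).
    by rewrite dmE'; exact: square_integrable_lincomb.
  apply: le_trans (sqnormf_le_sup hI mf f0 fM sd) _.
  have [x Ix _] := basis_point hI ophi 0.
  apply: ler_wpM2l; first by rewrite (le_trans (f0 x))// sup_f_ub.
  exact: (projection_le_inf hI sphi SdbI.2 pd).
rewrite -/rr -/y4 -/z4.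
have -> : 2 * cfrak R * n%:R / ln n%:R * opnorm Delta ^+ 2 * y4 = 2 * K * y4.
  by rewrite /K /C; ring.
by lra.
Qed.
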